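(* Let $n\ge 1$ and $h\ge 0$ be integers, and let $B$ be the matrix of the bilinear form $G$ on $\mathcal{S}(I\times I,n,h)$ with respect to the natural basis $\mathcal{B}_n^h$. Then $$\det(B)=\Delta_h^{|\mathcal{D}_n^h|}\prod_{k\ge 1}\left(\frac{\Delta_k}{\Delta_{k-1}}\right)^{\alpha^k_{(n,h)}},$$ where $$\alpha^k_{(n,h)}=\binom{n}{\frac{n+h+2k-2s}{2}}-\binom{n}{\frac{n+h+2k+2}{2}},\qquad s=\min\{k-1,h\}.$$
   Context: Let $A$ be a variable and let $\Lambda$ be $\mathbb{Z}[A,A^{-1}]$ localized by inverting the multiplicative set generated by $\{A^m-1\mid m\in\mathbb{Z}^+\}$. Put $I=[0,1]$ and $\delta=-A^2-A^{-2}$. For an oriented surface $F$ with $m$ specified points on $\partial F$, $\mathcal{S}(F,m)$ is the $\Lambda$-module of formal linear sums of tangle diagrams in $F$ with endpoints at the $m$ points, modulo: a trivial closed loop may be removed at the cost of a factor $\delta$, and the Kauffman bracket relation (a crossing equals $A$ times one smoothing plus $A^{-1}$ times the other). The Temperley-Lieb algebra $TL_m$ is $\mathcal{S}(I\times I,2m)$ with $m$ points on $I\times\{0\}$ and $m$ points on $I\times\{1\}$, with multiplication by stacking. It is generated by $1$ and $e_1,\dots,e_{m-1}$, where $e_i$ joins the $i$-th and $(i+1)$-st points at the bottom, likewise at the top, and is vertical elsewhere. The Jones-Wenzl idempotent $f_m\in TL_m$ is the unique element with $f_me_i=e_if_m=0$ for $1\le i\le m-1$, $f_m-1$ in the subalgebra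 generated by $e_1,\dots,e_{m-1}$, and $f_mf_m=f_m$ ($f_0$ is the empty diagram). The closure of $f_m$ evaluates to $\Delta_m=(-1)^m\frac{A^{2(m+1)}-A^{-2(m+1)}}{A^2-A^{-2}}$. $\mathcal{S}(I\times I,n,h)$ (the square with $n$ points colored $1$ on $I\times\{0\}$ and one point colored $h$ on $I\times\{1\}$) is the submodule of $\mathcal{S}(I\times I,n+h)$ (with $n$ points on the bottom side and $h$ points on the top side) consisting of the elements obtained by placing $f_h$ on top, at the $h$ top points. $\mathcal{B}_n^h$ is the set of elements of $\mathcal{S}(I\times I,n,h)$ obtained by placing $f_h$ on top of a crossing-free diagram (without closed components, up to isotopy) with $n$ bottom points and $h$ top points in which no arc joins two of the $h$ top points; it is a basis of $\mathcal{S}(I\times I,n,h)$. The $\Lambda$-bilinear form $G:\mathcal{S}(I\times I,n,h)\times\mathcal{S}(I\times I,n,h)\to\Lambda$ is given, on elements represented by crossing-free diagrams with $f_h$ attached, by gluing the first element to the reflection of the second in a horizontal line, joining the $i$-th bottom points to each other for $i=1,\dots,n$ and the $i$-th top points to each other for $i=1,\dots,h$ by parallel strands in the plane without crossings, and evaluating the resulting closed planar diagram by the Kauffman bracket (empty diagram $=1$, each loop $=\delta$). $|\mathcal{D}_n^h|$ denotes the number of tuples $(a_1,\dots,a_n)$ of non-negative integers with $a_1=1$, $a_n=h$ and $|a_i-a_{i+1}|=1$ for $1\le i\le n-1$. Convention: $\binom{a}{b}=0$ if $a<b$ or if $a,b$ are not non-negative integers. (Hence only finitely many factors in the product are different from $1$.)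 *)

(* Defs.v *)
From HB Require Import structures.
From mathcomp Require Import all_boot all_order all_algebra.
From mathcomp Require Import fraction generic_quotient ring_quotient.
From mathcomp Require Import archimedean.
From mathcomp.classical Require Import boolp classical_sets functions.
From mathcomp.classical Require Import cardinality fsbigop.
From mathcomp.multinomials Require Import monalg.
From mathcomp Require Import sesquilinear finmap.

Set Implicit Arguments.
Unset Strict Implicit.
Unset Printing Implicit Defensive.

Import Order.TTheory GRing.Theory Num.Theory.
Import Quotient.

Local Open Scope ring_scope.
Local Open Scope quotient_scope.
Local Open Scope classical_set_scope.

Local Notation "x %:F" := (tofrac x).

(* Z[A, 1/A] with the A^m - 1 inverted, as a subring of Q(A) = Frac Z['X];
   the fractions may have denominator 'X^k * prod (A^m - 1). *)
Definition Lambda_den (k : nat) (s : seq nat) : {poly int} :=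
  'X^k * \prod_(m <- s) ('X^(m.+1) - 1).

Definition in_Lambda : {pred {fraction {poly int}}} := fun x =>
  `[< exists (p : {poly int}) (k : nat) (s : seq nat),
        x = p%:F / (Lambda_den k s)%:F >].

Lemma Lambda_den_neq0 k s : (Lambda_den k s)%:F != 0.
Proof.
rewrite tofrac_eq0 mulf_neq0 ?monic_neq0 ?monicXn //.
by apply: monic_prod => m _; apply: monic_Xn_sub_1.
Qed.

Lemma Lambda_denM k s l t :
  Lambda_den k s * Lambda_den l t = Lambda_den (k + l) (s ++ t).
Proof. by rewrite /Lambda_den big_cat exprD mulrACA. Qed.

Lemma in_Lambda_subring : subring_closed in_Lambda.
Proof.
split.
- apply/asboolP; exists 1, 0%N, [::].
  by rewrite /Lambda_den big_nil mulr1 expr0 rmorph1 divr1.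
- move=> _ _ /asboolP[p [k [s ->]]] /asboolP[q [l [t ->]]]; apply/asboolP.
  exists (p * Lambda_den l t - q * Lambda_den k s), (k + l)%N, (s ++ t).
  rewrite -Lambda_denM; have := Lambda_den_neq0 l t; have := Lambda_den_neq0 k s.
  move: (Lambda_den k s) (Lambda_den l t) => d e d0 e0.
  rewrite tofracB !tofracM; move: p%:F q%:F d%:F e%:F d0 e0 => x y d' e' d0 e0.
  by rewrite -mulNr (addf_div _ _ d0 e0) mulNr.
- move=> _ _ /asboolP[p [k [s ->]]] /asboolP[q [l [t ->]]]; apply/asboolP.
  exists (p * q), (k + l)%N, (s ++ t).
  rewrite -Lambda_denM; move: (Lambda_den k s) (Lambda_den l t) => d e.
  by rewrite !tofracM; move: p%:F q%:F d%:F e%:F => *; rewrite mulf_div.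
Qed.

HB.instance Definition _ :=
  GRing.isSubringClosed.Build _ in_Lambda in_Lambda_subring.

Record Lambda := MkLambda {
  Lambda_val : {fraction {poly int}};
  _ : Lambda_val \in in_Lambda }.

HB.instance Definition _ := [isSub for Lambda_val].
HB.instance Definition _ := [Choice of Lambda by <:].
HB.instance Definition _ := [SubChoice_isSubComNzRing of Lambda by <:].

Definition Lambda_unit : {pred Lambda} :=
  fun x => (val x != 0) && ((val x)^-1 \in in_Lambda).
Definition Lambda_inv (x : Lambda) : Lambda := insubd x (val x)^-1.

Lemma Lambda_mulVr : {in Lambda_unit, left_inverse 1 Lambda_inv *%R}.
Proof.
move=> x /andP[x0 xV]; apply: val_inj.
by rewrite rmorphM rmorph1 /= val_insubd xV mulVf.
Qed.

Lemma Lambda_unitPl (x y : Lambda) : y * x = 1 -> Lambda_unit x.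
Proof.
move=> /(congr1 val); rewrite rmorphM rmorph1 /= => yx1.
have x0 : val x != 0.
  by apply: contra_eq_neq yx1 => ->; rewrite mulr0 eq_sym oner_eq0.
by rewrite /Lambda_unit x0 -[_^-1]mul1r -yx1 mulfK //; apply: valP.
Qed.

Lemma Lambda_inv_out : {in [predC Lambda_unit], Lambda_inv =1 id}.
Proof.
move=> x; rewrite inE /= [x \in _]unfold_in negb_and negbK => xNu.
apply: val_inj; rewrite val_insubd.
by case/orP: xNu => [/eqP-> | /negPf->//]; rewrite invr0 if_same.
Qed.

HB.instance Definition _ := GRing.ComNzRing_hasMulInverse.Build Lambda
  Lambda_mulVr Lambda_unitPl Lambda_inv_out.
HB.instance Definition _ :=
  [SubComUnitRing_isSubIntegralDomain of Lambda by <:].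

Lemma in_Lambda_X : ('X : {poly int})%:F \in in_Lambda.
Proof.
apply/asboolP; exists 'X, 0%N, [::].
by rewrite /Lambda_den big_nil mulr1 expr0 rmorph1 divr1.
Qed.

Definition A : Lambda := MkLambda in_Lambda_X.
Definition delta : Lambda := - A ^+ 2 - A ^- 2.
Definition Delta (m : nat) : Lambda :=
  (-1) ^+ m * ((A ^+ (2 * m.+1) - A ^- (2 * m.+1)) / (A ^+ 2 - A ^- 2)).

(* A tangle diagram in general position is cut by horizontal lines into layers,
   each containing one maximum, minimum or crossing.  Layers are listed from
   bottom to top; a layer [(p, i)] has [i] vertical strands to the left of its
   piece [p].  [Cup] is a local minimum (it creates strands [i] and [i.+1]),
   [Cap] a local maximum (it joins them), and [Cross b] a crossing, whose
   over-strand runs from bottom left to top right iff [b]. *)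
Variant piece := Cup | Cap | Cross of bool.

Definition piece_code (p : piece) : option (option bool) :=
  match p with Cup => None | Cap => Some None | Cross b => Some (Some b) end.
Definition piece_decode (c : option (option bool)) : piece :=
  match c with None => Cup | Some None => Cap | Some (Some b) => Cross b end.
Lemma piece_codeK : cancel piece_code piece_decode. Proof. by case. Qed.
HB.instance Definition _ := Choice.copy piece (can_type piece_codeK).

Definition layer := (piece * nat)%type.

Definition inputs (p : piece) : nat := if p is Cup then 0 else 2.
Definition outputs (p : piece) : nat := if p is Cap then 0 else 2.

(* Number of strands above a word of layers that has [n] strands below, or
   [None] if some layer does not fit. *)
Fixpoint target (n : nat) (w : seq layer) : option nat :=
  if w is (p, i) :: w' then
    if (i + inputs p <= n)%N then target (n - inputs p + outputs p) w' else None
  else Some n.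

Lemma target_cat n w w' :
  target n (w ++ w') = obind (fun k => target k w') (target n w).
Proof. by elim: w n => [//|[p i] w IHw] n /=; case: ifP. Qed.

Record tangle (n m : nat) := Tangle {
  layers :> seq layer;
  _ : target n layers == Some m }.

HB.instance Definition _ n m := [isSub for @layers n m].
HB.instance Definition _ n m := [Choice of tangle n m by <:].

Lemma id_tangle_subproof n : target n [::] == Some n. Proof. exact: eqxx. Qed.
Definition id_tangle n : tangle n n := Tangle (id_tangle_subproof n).

Lemma cat_tangle_subproof n k m (t : tangle n k) (u : tangle k m) :
  target n (t ++ u) == Some m.
Proof.
by case: t u => [t tP] [u uP] /=; rewrite target_cat (eqP tP) /=.
Qed.

(* [t] below, [u] on top *)
Definition cat_tangle n k m (t : tangle n k) (u : tangle k m) : tangle n m :=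
  Tangle (cat_tangle_subproof t u).

Lemma cat_tangleA n k l m (t : tangle n k) (u : tangle k l) (v : tangle l m) :
  cat_tangle (cat_tangle t u) v = cat_tangle t (cat_tangle u v).
Proof. by apply: val_inj; rewrite /= catA. Qed.

Definition crossing_free (w : seq layer) : bool :=
  all (fun x => if x.1 is Cross _ then false else true) w.

(* The elementary planar isotopies between diagrams cut into layers: exchanging
   the heights of two distant pieces, straightening a zigzag, and turning a
   crossing around a minimum or a maximum. *)
Inductive isotopy : seq layer -> seq layer -> Prop :=
| isotopy_exchange p q i j of (i <= j)%N :
    isotopy [:: (p, i); (q, j + outputs p)%N] [:: (q, j + inputs p)%N; (p, i)]
| isotopy_zigzagl i : isotopy [:: (Cup, i); (Cap, i.+1)] [::]
| isotopy_zigzagr i : isotopy [:: (Cup, i.+1); (Cap, i)] [::]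
| isotopy_min b i :
    isotopy [:: (Cup, i); (Cross b, i.+1)] [:: (Cup, i.+1); (Cross (~~ b), i)]
| isotopy_max b i :
    isotopy [:: (Cross b, i.+1); (Cap, i)] [:: (Cross (~~ b), i); (Cap, i.+1)].

Definition formal (n m : nat) := {malg Lambda[tangle n m]}.

HB.instance Definition _ n m := GRing.Lmodule.on (formal n m).

(* The submodule generated by the differences of isotopic diagrams, the removal
   of a trivial loop, and the Kauffman bracket relation. *)
Inductive skein_null (n m : nat) : formal n m -> Prop :=
| skein_null0 : skein_null 0
| skein_nullD x y of skein_null x & skein_null y : skein_null (x + y)
| skein_nullZ c x of skein_null x : skein_null (c *: x)
| skein_null_isotopy k l (u : tangle n k) (s t : tangle k l) (v : tangle l m)
    of isotopy s t :
    skein_null (<< cat_tangle (cat_tangle u s) v >>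
                - << cat_tangle (cat_tangle u t) v >>)
| skein_null_loop k (u : tangle n k) (o : tangle k k) (v : tangle k m) i
    of layers o = [:: (Cup, i); (Cap, i)] :
    skein_null (<< cat_tangle (cat_tangle u o) v >>
                - delta *: << cat_tangle u v >>)
| skein_null_bracket k (u : tangle n k) (x e : tangle k k) (v : tangle k m) b i
    of layers x = [:: (Cross b, i)] & layers e = [:: (Cap, i); (Cup, i)] :
    skein_null (<< cat_tangle (cat_tangle u x) v >>
                - (if b then A else A^-1) *: << cat_tangle u v >>
                - (if b then A^-1 else A) *: << cat_tangle (cat_tangle u e) v >>).

Definition skein_rel n m : {pred formal n m} := fun x => `[< skein_null x >].

Lemma skein_rel_submod n m : submod_closed (@skein_rel n m).
Proof.
split=> [|c x y /asboolP nx /asboolP ny]; apply/asboolP.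
  exact: skein_null0.
by apply: skein_nullD => //; apply: skein_nullZ.
Qed.

HB.instance Definition _ n m :=
  GRing.isSubmodClosed.Build _ _ (@skein_rel n m) (@skein_rel_submod n m).

(* The skein module of the square with [n] points on the bottom side and [m]
   points on the top side. *)
Definition skein (n m : nat) := {quot (@skein_rel n m)}.

HB.instance Definition _ n m := GRing.Zmodule.on (skein n m).
HB.instance Definition _ n m := EqQuotient.on (skein n m).
HB.instance Definition _ n m := ZmodQuotient.on (skein n m).

Lemma skein_eqP n m (x y : formal n m) :
  reflect (\pi_(skein n m) x = \pi_(skein n m) y) (x - y \in @skein_rel n m).
Proof. by rewrite Quotient.idealrBE; apply: eqP. Qed.

Definition skein_scale n m (c : Lambda) (x : skein n m) : skein n m :=
  \pi_(skein n m) (c *: repr x).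

Lemma pi_skein_scale n m c (x : formal n m) :
  skein_scale c (\pi_(skein n m) x) = \pi_(skein n m) (c *: x).
Proof.
apply/skein_eqP; rewrite -scalerBr rpredZ //; apply/skein_eqP.
by rewrite reprK.
Qed.

Lemma skein_scalerA n m (a b : Lambda) (x : skein n m) :
  skein_scale a (skein_scale b x) = skein_scale (a * b) x.
Proof. by elim/quotW: x => x; rewrite (pi_skein_scale b x) !pi_skein_scale scalerA. Qed.

Lemma skein_scale1r n m : left_id 1 (@skein_scale n m).
Proof. by elim/quotW=> x; rewrite pi_skein_scale scale1r. Qed.

Lemma skein_scalerDr n m : right_distributive (@skein_scale n m) +%R.
Proof.
move=> c; elim/quotW=> x; elim/quotW=> y.
by rewrite -raddfD !pi_skein_scale scalerDr raddfD.
Qed.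

Lemma skein_scalerDl n m (x : skein n m) :
  {morph (@skein_scale n m)^~ x : a b / a + b}.
Proof.
by move=> a b; elim/quotW: x => x; rewrite !pi_skein_scale scalerDl raddfD.
Qed.

HB.instance Definition _ n m := GRing.Zmodule_isLmodule.Build Lambda (skein n m)
  (@skein_scalerA n m) (@skein_scale1r n m) (@skein_scalerDr n m)
  (@skein_scalerDl n m).

Lemma pi_skeinZ n m c (x : formal n m) :
  \pi_(skein n m) (c *: x) = c *: \pi_(skein n m) x.
Proof. by rewrite -pi_skein_scale. Qed.

Lemma pi_skeinP n m c (x y : formal n m) :
  \pi_(skein n m) (c *: x + y) = c *: \pi_(skein n m) x + \pi_(skein n m) y.
Proof. by rewrite -pi_skeinZ -raddfD. Qed.

Definition skein_class n m (t : tangle n m) : skein n m :=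
  \pi_(skein n m) << t >>.

Definition lin_ext (R : nzRingType) (K : choiceType) (M : lmodType R) (f : K -> M)
  (D : {malg R[K]}) : M := \sum_(x <- msupp D) D@_x *: f x.

Lemma lin_extEw (R : nzRingType) (K : choiceType) (M : lmodType R) (f : K -> M)
    (D : {malg R[K]}) (S : {fset K}) :
  (msupp D `<=` S)%fset -> lin_ext f D = \sum_(x <- S) D@_x *: f x.
Proof.
move=> DS; rewrite /lin_ext (big_fset_incl _ DS) // => x _ xD.
by rewrite mcoeff_outdom // scale0r.
Qed.

Lemma lin_extU (R : nzRingType) (K : choiceType) (M : lmodType R) (f : K -> M) x :
  lin_ext f (<< x >> : {malg R[K]}) = f x.
Proof. by rewrite (lin_extEw _ msuppU_le) big_seq_fset1 mcoeffUU scale1r. Qed.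

Lemma lin_ext_is_linear (R : nzRingType) (K : choiceType) (M : lmodType R)
  (f : K -> M) : linear (lin_ext f : {malg R[K]} -> M).
Proof.
move=> c x y; pose S := (msupp x `|` msupp y `|` msupp (c *: x + y))%fset.
have [xS yS] : (msupp x `<=` S /\ msupp y `<=` S)%fset.
  by split; apply/fsubsetP => k kx; rewrite !inE kx ?orbT.
rewrite (lin_extEw f xS) (lin_extEw f yS) (@lin_extEw _ _ _ f _ S) ?fsubsetUr //.
rewrite scaler_sumr -big_split /=; apply: eq_bigr => k _.
by rewrite mcoeffD mcoeffZ scalerDl scalerA.
Qed.

Definition formal_cat n k m (x : formal n k) (y : formal k m) : formal n m :=
  lin_ext (fun t => lin_ext (fun u => << cat_tangle t u >>) y) x.

Lemma formal_catE n k m (x : formal n k) (y : formal k m) :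
  formal_cat x y = \sum_(t <- msupp x) \sum_(u <- msupp y)
    (x@_t * y@_u) *: << cat_tangle t u >>.
Proof.
rewrite /formal_cat /lin_ext; apply: eq_bigr => t _.
by rewrite /lin_ext scaler_sumr; apply: eq_bigr => u _; rewrite scalerA.
Qed.

Lemma formal_catEr n k m (x : formal n k) (y : formal k m) :
  formal_cat x y = lin_ext (fun u => lin_ext (fun t => << cat_tangle t u >>) x) y.
Proof.
rewrite formal_catE exchange_big /lin_ext; apply: eq_bigr => u _ /=.
rewrite /lin_ext scaler_sumr; apply: eq_bigr => t _.
by rewrite scalerA mulrC.
Qed.

Lemma formal_cat_linearl n k m (y : formal k m) :
  linear (fun x : formal n k => formal_cat x y).
Proof. exact: lin_ext_is_linear. Qed.

Lemma formal_cat_linearr n k m (x : formal n k) :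
  linear (fun y : formal k m => formal_cat x y).
Proof. by move=> c y z; rewrite !formal_catEr lin_ext_is_linear. Qed.

Lemma formal_cat1 n k m (t : tangle n k) (u : tangle k m) :
  formal_cat << t >> << u >> = << cat_tangle t u >> :> formal n m.
Proof. by rewrite /formal_cat !lin_extU. Qed.

Lemma lin0 (U V : lmodType Lambda) (f : U -> V) : linear f -> f 0 = 0.
Proof. by move=> fl; rewrite -[in LHS](addNr 0) -scaleN1r fl scaleN1r addNr. Qed.

Lemma linD (U V : lmodType Lambda) (f : U -> V) :
  linear f -> {morph f : x y / x + y}.
Proof. by move=> fl x y; rewrite -[x in LHS]scale1r fl scale1r. Qed.

Lemma linZ (U V : lmodType Lambda) (f : U -> V) : linear f -> scalable f.
Proof. by move=> fl c x; rewrite -[_ *: x]addr0 fl lin0 // addr0. Qed.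

Lemma linB (U V : lmodType Lambda) (f : U -> V) :
  linear f -> {morph f : x y / x - y}.
Proof. by move=> fl x y; rewrite linD // -scaleN1r linZ // scaleN1r. Qed.

Lemma skein_null_linear n k (U : lmodType Lambda) (P : submodClosed U)
    (f : formal n k -> U) (f_linear : linear f) :
    (forall i j (u : tangle n i) (s t : tangle i j) (v : tangle j k),
      isotopy s t ->
      f << cat_tangle (cat_tangle u s) v >>
      - f << cat_tangle (cat_tangle u t) v >> \in P) ->
    (forall i (u : tangle n i) (o : tangle i i) (v : tangle i k) j,
      layers o = [:: (Cup, j); (Cap, j)] ->
      f << cat_tangle (cat_tangle u o) v >>
      - delta *: f << cat_tangle u v >> \in P) ->
    (forall i (u : tangle n i) (x e : tangle i i) (v : tangle i k) b j,
      layers x = [:: (Cross b, j)] -> layers e = [:: (Cap, j); (Cup, j)] ->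
      f << cat_tangle (cat_tangle u x) v >>
      - (if b then A else A^-1) *: f << cat_tangle u v >>
      - (if b then A^-1 else A) *: f << cat_tangle (cat_tangle u e) v >>
        \in P) ->
  forall x, x \in @skein_rel n k -> f x \in P.
Proof.
move=> f_iso f_loop f_bracket x /asboolP.
elim=> {x} [|x y _ fx _ fy|c x _ fx|i j u s t v st|i u o v j Eo|i u x e v b j Ex Ee].
- by rewrite (lin0 f_linear) rpred0.
- by rewrite (linD f_linear) rpredD.
- by rewrite (linZ f_linear) rpredZ.
- have := f_iso _ _ u s t v st.
  by move: << _ >> << _ >> => p q; rewrite (linB f_linear).
- have := f_loop _ u o v _ Eo.
  by move: << _ >> << _ >> => p q; rewrite (linB f_linear) (linZ f_linear).
have := f_bracket _ u x e v _ _ Ex Ee; move: << _ >> << _ >> << _ >> => p q r.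
by rewrite !(linB f_linear) !(linZ f_linear).
Qed.

Lemma formal_cat_nulll n k m (x : formal n k) (y : formal k m) :
  x \in @skein_rel n k -> formal_cat x y \in @skein_rel n m.
Proof.
move=> nx; rewrite formal_catEr {1}/lin_ext rpred_sum // => w _; rewrite rpredZ //.
move: x nx; apply: skein_null_linear; first exact: lin_ext_is_linear.
- move=> i j u s t v st; rewrite !lin_extU !cat_tangleA.
  rewrite -(cat_tangleA u s) -(cat_tangleA u t).
  by apply/asboolP; apply: skein_null_isotopy.
- move=> i u o v j Eo; rewrite !lin_extU !cat_tangleA -(cat_tangleA u o).
  by apply/asboolP; apply: skein_null_loop Eo.
move=> i u t e v b j Et Ee; rewrite !lin_extU !cat_tangleA.
rewrite -(cat_tangleA u t) -(cat_tangleA u e).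
by apply/asboolP; apply: skein_null_bracket Et Ee.
Qed.

Lemma formal_cat_nullr n k m (x : formal n k) (y : formal k m) :
  y \in @skein_rel k m -> formal_cat x y \in @skein_rel n m.
Proof.
move=> ny; rewrite /formal_cat {1}/lin_ext rpred_sum // => w _; rewrite rpredZ //.
move: y ny; apply: skein_null_linear; first exact: lin_ext_is_linear.
- move=> i j u s t v st; rewrite !lin_extU -!cat_tangleA.
  by apply/asboolP; apply: skein_null_isotopy.
- move=> i u o v j Eo; rewrite !lin_extU -!cat_tangleA.
  by apply/asboolP; apply: skein_null_loop Eo.
move=> i u t e v b j Et Ee; rewrite !lin_extU -!cat_tangleA.
by apply/asboolP; apply: skein_null_bracket Et Ee.
Qed.

Lemma formal_cat_congr n k m (x x' : formal n k) (y y' : formal k m) :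
  x' - x \in @skein_rel n k -> y' - y \in @skein_rel k m ->
  formal_cat x' y' - formal_cat x y \in @skein_rel n m.
Proof.
move=> nx ny; have := rpredD (formal_cat_nulll y' nx) (formal_cat_nullr x ny).
rewrite (linB (formal_cat_linearl y')) (linB (formal_cat_linearr x)).
by move: (formal_cat x y') => z; rewrite addrA subrK.
Qed.

(* [x] below, [y] on top *)
Definition stack n k m (x : skein n k) (y : skein k m) : skein n m :=
  \pi_(skein n m) (formal_cat (repr x) (repr y)).

Lemma pi_stack n k m (x : formal n k) (y : formal k m) :
  stack (\pi_(skein n k) x) (\pi_(skein k m) y)
    = \pi_(skein n m) (formal_cat x y).
Proof.
apply/skein_eqP; apply: formal_cat_congr; apply/skein_eqP; exact: reprK.
Qed.

Lemma stack_linearl n k m (y : skein k m) :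
  linear (fun x : skein n k => stack x y).
Proof.
move=> c; elim/quotW: y => y; elim/quotW=> x; elim/quotW=> x'.
by rewrite -pi_skeinP (pi_stack x y) (pi_stack x' y) pi_stack -pi_skeinP
  formal_cat_linearl.
Qed.

Lemma stack_linearr n k m (x : skein n k) :
  linear (fun y : skein k m => stack x y).
Proof.
move=> c; elim/quotW: x => x; elim/quotW=> y; elim/quotW=> y'.
by rewrite -pi_skeinP (pi_stack x y) (pi_stack x y') pi_stack -pi_skeinP
  formal_cat_linearr.
Qed.

Lemma hook_subproof m (i : 'I_m.-1) :
  target m [:: (Cap, i : nat); (Cup, i : nat)] == Some m.
Proof.
case: m i => [[]//|[[]//|m i]] /=.
by rewrite addn2 ltnS ltn_ord subn2 addn0 addn0 -ltnS ltn_ord subn0 /= addn2.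
Qed.

Definition hook m (i : 'I_m.-1) : skein m m :=
  skein_class (Tangle (hook_subproof i)).

Definition TL_one m : skein m m := skein_class (id_tangle m).

(* The subalgebra generated by the hooks does not contain the unit. *)
Inductive hook_algebra (m : nat) : skein m m -> Prop :=
| hook_algebra0 : hook_algebra 0
| hook_algebra_hook i : hook_algebra (hook i)
| hook_algebraD x y of hook_algebra x & hook_algebra y : hook_algebra (x + y)
| hook_algebraZ c x of hook_algebra x : hook_algebra (c *: x)
| hook_algebraM x y of hook_algebra x & hook_algebra y :
    hook_algebra (stack x y).

Definition is_Jones_Wenzl m (f : skein m m) : Prop :=
  [/\ forall i, stack f (hook i) = 0 /\ stack (hook i) f = 0,
      hook_algebra (f - TL_one m) & stack f f = f].

(* The unique element satisfying [is_Jones_Wenzl]. *)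
Definition Jones_Wenzl m : skein m m := xget 0 [set f | is_Jones_Wenzl f].

Definition in_colored n h : {pred skein n h} := fun x =>
  `[< exists y : skein n h, x = stack y (Jones_Wenzl h) >].

Lemma in_colored_submod n h : submod_closed (@in_colored n h).
Proof.
split=> [|c _ _ /asboolP[x ->] /asboolP[y ->]]; apply/asboolP.
  by exists (0 - 0); rewrite -scaleN1r addrC stack_linearl scaleN1r addNr.
by exists (c *: x + y); rewrite stack_linearl.
Qed.

HB.instance Definition _ n h :=
  GRing.isSubmodClosed.Build _ _ (@in_colored n h) (@in_colored_submod n h).

Record colored (n h : nat) := Colored {
  colored_val : skein n h;
  _ : colored_val \in @in_colored n h }.

HB.instance Definition _ n h := [isSub for @colored_val n h].
HB.instance Definition _ n h := [Choice of colored n h by <:].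
HB.instance Definition _ n h := [SubChoice_isSubLmodule of colored n h by <:].

Lemma place_subproof n h (y : skein n h) :
  stack y (Jones_Wenzl h) \in @in_colored n h.
Proof. by apply/asboolP; exists y. Qed.

Definition place n h (y : skein n h) : colored n h :=
  Colored (place_subproof y).

(* Following the strands from bottom to top: the state lists the labels of the
   strands at the current height, the next unused label, and the number of
   closed components met so far.  Strands at the current height carry the same
   label iff they are joined below it; hence a cap closes a component iff its
   two feet carry the same label. *)
Definition trace_state := (seq nat * nat * nat)%type.

Definition trace_step (st : trace_state) (x : layer) : trace_state :=
  let: (s, c, loops) := st in
  let: (p, i) := x in
  let a := nth 0%N s i in
  let b := nth 0%N s i.+1 in
  match p with
  | Cup => (take i s ++ [:: c; c] ++ drop i s, c.+1, loops)
  | Cap =>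
      let s' := take i s ++ drop i.+2 s in
      if a == b then (s', c, loops.+1)
      else ([seq if z == b then a else z | z <- s'], c, loops)
  | Cross _ => (take i s ++ [:: b; a] ++ drop i.+2 s, c, loops)
  end.

Definition trace (n : nat) (w : seq layer) : trace_state :=
  foldl trace_step (iota 0 n, n, 0%N) w.

Definition closed_components (n : nat) (w : seq layer) : nat := (trace n w).2.
Definition top_labels (n : nat) (w : seq layer) : seq nat := (trace n w).1.1.

(* Crossing-free, without closed components, no arc joining two top points. *)
Definition basis_diagram n h (d : tangle n h) : bool :=
  [&& crossing_free d, closed_components n d == 0%N & uniq (top_labels n d)].

Definition natural_basis n h : set (colored n h) :=
  [set place (skein_class d) | d in [set d : tangle n h | basis_diagram d]].

Arguments natural_basis : clear implicits.

Definition reflect_piece (p : piece) : piece :=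
  match p with Cup => Cap | Cap => Cup | Cross b => Cross (~~ b) end.

Definition reflect_word (w : seq layer) : seq layer :=
  rev [seq (reflect_piece x.1, x.2) | x <- w].

(* [d] on top of the reflection of [d'], glued along their bottom points, and
   closed by [h] nested arcs passing to the right and joining the i-th top point
   of [d'] to the i-th top point of [d]. *)
Definition glue (h : nat) (d d' : seq layer) : seq layer :=
  [seq (Cup, i) | i <- iota 0 h] ++ reflect_word d' ++ d
    ++ rev [seq (Cap, i) | i <- iota 0 h].

(* Crossing-free diagrams span [skein n h], so there is at most one such [B]. *)
Definition is_gluing_form n h (B : skein n h -> skein n h -> Lambda) : Prop :=
  bilinear_for *%R *%R B /\
  forall d d' : tangle n h, crossing_free d -> crossing_free d' ->
    B (skein_class d) (skein_class d') = delta ^+ closed_components 0 (glue h d d').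

Definition gluing_form n h : skein n h -> skein n h -> Lambda :=
  xget (fun _ _ => 0) [set B | is_gluing_form B].

Definition gram_form n h (x y : colored n h) : Lambda :=
  gluing_form (val x) (val y).

Definition D_paths (n h : nat) : set (n.-tuple nat) :=
  [set a | [/\ nth 0%N a 0 = 1%N, nth 0%N a n.-1 = h
           & forall i, (i.+1 < n)%N -> `|nth 0%N a i - nth 0%N a i.+1|%N = 1%N]].

Arguments D_paths : clear implicits.

Definition card_D (n h : nat) : nat := #|` fset_set (D_paths n h)|.

(* 0 unless both arguments are natural numbers *)
Definition binom (a b : rat) : nat :=
  if (a \is a Num.nat) && (b \is a Num.nat)
  then 'C(Num.truncn a, Num.truncn b) else 0%N.

Definition alpha (n h k : nat) : int :=
  let s := minn k.-1 h in
  (binom n%:R (((n + h + 2 * k)%:R - (2 * s)%:R) / 2))%:Z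
  - (binom n%:R ((n + h + 2 * k + 2)%:R / 2))%:Z.

(* Main.v *)
(* Crossing-free words of layers are brought to a normal form, all maxima below
   all minima, by planar isotopies and removal of loops.  The bookkeeping of
   [trace] is preserved up to renaming labels, so that the number of closed
   components can be read off, and the natural basis consists of the words of
   maxima only, indexed by the paths counted by [card_D].  A state sum gives a
   functional on [skein 0 0], hence the existence of the gluing form.

   In the category of tangles, modulo [f_h] on top, [y^* x f_h = g(x, y) f_h] for
   a scalar form [g] with [G = g * Delta h].  A basis element with [n.+1] bottom
   points is either [d] with a strand added or [d] with a strand added and its
   last two top points joined.  Replacing [d] by [f_(h.+2) d] in the second kind
   is a unitriangular change of basis (Wenzl's recursion) that makes the two
   kinds orthogonal, and the partial trace of [f_(h.+2)] yields
     det g(n.+1, h.+1)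
       = det g(n, h) * det g(n, h.+2) * (Delta h.+2 / Delta h.+1) ^ #paths(n, h.+2).
   The exponents then count the steps from [k] down to [k - 1] in paths. *)

Require Import Defs.
From mathcomp Require Import all_boot all_order all_algebra.
From mathcomp.classical Require Import boolp classical_sets functions.
From mathcomp.classical Require Import cardinality fsbigop.
From mathcomp.multinomials Require Import monalg.
From mathcomp Require Import finmap perm zify ring.

Set Implicit Arguments.
Unset Strict Implicit.
Unset Printing Implicit Defensive.

Import GRing.Theory Num.Theory.
Local Open Scope quotient_scope.
Local Open Scope ring_scope.
Local Open Scope classical_set_scope.

(** * Temperley-Lieb categories *)

(** Independence of the natural basis is not established beforehand. Only spanning is proved, and
    only after an element killed by the hooks is placed on top. The determinant is then computed for
    the family indexed by paths; as every [Delta k] is a unit of [Lambda], it is nonzero, which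
    makes that family injective and identifies every enumeration of the natural basis with it up to
    a permutation. The algebra runs in an abstract [TL_category], away from the skein quotient. All
    its operations act at the right edge: there a new strand leaves a word of layers unchanged, and
    arities are successors, so that no transport between types arises. What these axioms do not give
    is the hypothesis [span], which the normal form of words supplies. The evaluation [tl_eval]
    cannot be read off from normal forms, since a word may be reduced in many ways; the state sum is
    checked against each relation and thus settles that the value is well defined. *)

Fixpoint npaths n h : nat :=
  match n, h with
  | 0, 0 => 1%N
  | 0, _.+1 => 0%N
  | n'.+1, 0 => npaths n' 1%N
  | n'.+1, h'.+1 => (npaths n' h' + npaths n' h'.+2)%N
  end.

(* [tl_comp x y] has [x] below and [y] on top; [tl_wid] adds a strand on the
   right, [tl_flip] reflects in a horizontal line, and [tl_cap n], [tl_cup n]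
   join the two rightmost of [n.+2] points. *)
Record TL_category (R : comUnitRingType) (d : R) := {
  tl_hom :> nat -> nat -> lmodType R;
  tl_comp : forall n k m, tl_hom n k -> tl_hom k m -> tl_hom n m;
  tl_id : forall n, tl_hom n n;
  tl_wid : forall n m, tl_hom n m -> tl_hom n.+1 m.+1;
  tl_flip : forall n m, tl_hom n m -> tl_hom m n;
  tl_cap : forall n, tl_hom n.+2 n;
  tl_cup : forall n, tl_hom n n.+2;
  tl_comp_linearl : forall n k m (y : tl_hom k m),
    linear (fun x : tl_hom n k => tl_comp x y);
  tl_comp_linearr : forall n k m (x : tl_hom n k),
    linear (fun y : tl_hom k m => tl_comp x y);
  tl_compA : forall n k l m (x : tl_hom n k) (y : tl_hom k l) (z : tl_hom l m),
    tl_comp x (tl_comp y z) = tl_comp (tl_comp x y) z;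
  tl_comp1l : forall n m (x : tl_hom n m), tl_comp (tl_id n) x = x;
  tl_comp1r : forall n m (x : tl_hom n m), tl_comp x (tl_id m) = x;
  tl_wid_linear : forall n m, linear (@tl_wid n m);
  tl_wid_comp : forall n k m (x : tl_hom n k) (y : tl_hom k m),
    tl_wid (tl_comp x y) = tl_comp (tl_wid x) (tl_wid y);
  tl_wid1 : forall n, tl_wid (tl_id n) = tl_id n.+1;
  tl_flip_linear : forall n m, linear (@tl_flip n m);
  tl_flip_comp : forall n k m (x : tl_hom n k) (y : tl_hom k m),
    tl_flip (tl_comp x y) = tl_comp (tl_flip y) (tl_flip x);
  tl_flip1 : forall n, tl_flip (tl_id n) = tl_id n;
  tl_flip_wid : forall n m (x : tl_hom n m), tl_flip (tl_wid x) = tl_wid (tl_flip x);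
  tl_flip_cap : forall n, tl_flip (tl_cap n) = tl_cup n;
  tl_flip_cup : forall n, tl_flip (tl_cup n) = tl_cap n;
  tl_flipK : forall n m (x : tl_hom n m), tl_flip (tl_flip x) = x;
  tl_cup_cap : forall n, tl_comp (tl_cup n) (tl_cap n) = d *: tl_id n;
  tl_wid_cup_cap : forall n, tl_comp (tl_wid (tl_cup n)) (tl_cap n.+1) = tl_id n.+1;
  tl_cup_wid_cap : forall n, tl_comp (tl_cup n.+1) (tl_wid (tl_cap n)) = tl_id n.+1;
  tl_cap_natural : forall n m (x : tl_hom n m),
    tl_comp (tl_cap n) x = tl_comp (tl_wid (tl_wid x)) (tl_cap m);
  tl_cup_natural : forall n m (x : tl_hom n m),
    tl_comp x (tl_cup m) = tl_comp (tl_cup n) (tl_wid (tl_wid x));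
  tl_eval : tl_hom 0 0 -> R;
  tl_eval_linear : forall c x y, tl_eval (c *: x + y) = c * tl_eval x + tl_eval y;
  tl_eval1 : tl_eval (tl_id 0) = 1 }.

Section TemperleyLieb.
Variables (R : comUnitRingType) (d : R) (C : TL_category d).
Local Notation "x ** y" := (tl_comp x y) (at level 40, left associativity).
Local Notation one := (tl_id C).
Local Notation cap := (tl_cap C).
Local Notation cup := (tl_cup C).
Local Notation wid := (@tl_wid _ _ C _ _).
Local Notation flip := (@tl_flip _ _ C _ _).

Lemma linear_form (U V : lmodType R) (f : U -> V) : linear f ->
  [/\ f 0 = 0, {morph f : x y / x + y}, {morph f : x y / x - y}
    & scalable f].
Proof.
move=> fl; have f0 : f 0 = 0 by rewrite -[in LHS](addNr 0) -scaleN1r fl scaleN1r addNr.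
have fD : {morph f : x y / x + y} by move=> x y; rewrite -[x in LHS]scale1r fl scale1r.
have fZ : scalable f by move=> c x; rewrite -[_ *: x]addr0 fl f0 addr0.
by split=> // x y; rewrite fD -scaleN1r fZ scaleN1r.
Qed.

Lemma compDl n k m (x y : C n k) (z : C k m) : (x + y) ** z = x ** z + y ** z.
Proof. by have [_ + _ _] := linear_form (@tl_comp_linearl _ _ _ n _ _ z); apply. Qed.

Lemma compBl n k m (x y : C n k) (z : C k m) : (x - y) ** z = x ** z - y ** z.
Proof. by have [_ _ + _] := linear_form (@tl_comp_linearl _ _ _ n _ _ z); apply. Qed.

Lemma compZl n k m c (x : C n k) (z : C k m) : (c *: x) ** z = c *: (x ** z).
Proof. by have [_ _ _] := linear_form (@tl_comp_linearl _ _ _ n _ _ z); apply. Qed.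

Lemma comp0l n k m (z : C k m) : (0 : C n k) ** z = 0.
Proof. by have [? _ _ _] := linear_form (@tl_comp_linearl _ _ _ n _ _ z). Qed.

Lemma compDr n k m (x : C n k) (y z : C k m) : x ** (y + z) = x ** y + x ** z.
Proof. by have [_ + _ _] := linear_form (@tl_comp_linearr _ _ _ _ _ m x); apply. Qed.

Lemma compBr n k m (x : C n k) (y z : C k m) : x ** (y - z) = x ** y - x ** z.
Proof. by have [_ _ + _] := linear_form (@tl_comp_linearr _ _ _ _ _ m x); apply. Qed.

Lemma compZr n k m c (x : C n k) (y : C k m) : x ** (c *: y) = c *: (x ** y).
Proof. by have [_ _ _] := linear_form (@tl_comp_linearr _ _ _ _ _ m x); apply. Qed.

Lemma comp0r n k m (x : C n k) : x ** (0 : C k m) = 0.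
Proof. by have [? _ _ _] := linear_form (@tl_comp_linearr _ _ _ _ _ m x). Qed.

Lemma widD n m (x y : C n m) : wid (x + y) = wid x + wid y.
Proof. by have [_ + _ _] := linear_form (@tl_wid_linear _ _ C n m); apply. Qed.

Lemma widB n m (x y : C n m) : wid (x - y) = wid x - wid y.
Proof. by have [_ _ + _] := linear_form (@tl_wid_linear _ _ C n m); apply. Qed.

Lemma widZ n m c (x : C n m) : wid (c *: x) = c *: wid x.
Proof. by have [_ _ _] := linear_form (@tl_wid_linear _ _ C n m); apply. Qed.

Lemma wid0 n m : wid (0 : C n m) = 0.
Proof. by have [? _ _ _] := linear_form (@tl_wid_linear _ _ C n m). Qed.

Lemma flipD n m (x y : C n m) : flip (x + y) = flip x + flip y.
Proof. by have [_ + _ _] := linear_form (@tl_flip_linear _ _ C n m); apply. Qed.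

Lemma flipB n m (x y : C n m) : flip (x - y) = flip x - flip y.
Proof. by have [_ _ + _] := linear_form (@tl_flip_linear _ _ C n m); apply. Qed.

Lemma flipZ n m c (x : C n m) : flip (c *: x) = c *: flip x.
Proof. by have [_ _ _] := linear_form (@tl_flip_linear _ _ C n m); apply. Qed.

Lemma flip0 n m : flip (0 : C n m) = 0.
Proof. by have [? _ _ _] := linear_form (@tl_flip_linear _ _ C n m). Qed.

Definition last_hook n : C n.+2 n.+2 := cap n ** cup n.

(** Recursion on the number of strands: a hook either avoids the rightmost strand, and is then a
    widened one, or is the last. No position index occurs; [is_hookP] recovers it for words. *)
Fixpoint is_hook n : C n n -> Prop :=
  match n return C n n -> Prop with
  | 0 => fun _ => False
  | k.+1 => fun x => (exists2 y, is_hook y & x = wid y) \/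
      (match k return C k.+1 k.+1 -> Prop with
       | 0 => fun _ => False
       | j.+1 => fun x => x = last_hook j
       end) x
  end.

Inductive hook_span n : C n n -> Prop :=
| hook_span0 : hook_span 0
| hook_span_hook x of is_hook x : hook_span x
| hook_spanD x y of hook_span x & hook_span y : hook_span (x + y)
| hook_spanZ c x of hook_span x : hook_span (c *: x)
| hook_spanM x y of hook_span x & hook_span y : hook_span (x ** y).

Definition killsl n (f : C n n) := forall e, is_hook e -> e ** f = 0.
Definition killsr n (f : C n n) := forall e, is_hook e -> f ** e = 0.

Lemma hook_spanB n (x y : C n n) : hook_span x -> hook_span y -> hook_span (x - y).
Proof. by move=> hx hy; rewrite -scaleN1r; apply/hook_spanD/hook_spanZ. Qed.

Lemma hook_span_wid n (x : C n n) : hook_span x -> hook_span (wid x).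
Proof.
elim=> {x} [|x hx|x y _ hx _ hy|c x _ hx|x y _ hx _ hy].
- rewrite wid0; exact: hook_span0.
- by apply: hook_span_hook; left; exists x.
- by rewrite widD; apply: hook_spanD.
- by rewrite widZ; apply: hook_spanZ.
by rewrite tl_wid_comp; apply: hook_spanM.
Qed.

Lemma is_hook_flip n (x : C n n) : is_hook x -> is_hook (flip x).
Proof.
elim: n x => [//|n IHn] x /= [[y /IHn hy ->]|].
  by left; exists (flip y); rewrite ?tl_flip_wid.
case: n {IHn} x => [//|n] x ->; right.
by rewrite tl_flip_comp tl_flip_cap tl_flip_cup.
Qed.

Lemma hook_span_flip n (x : C n n) : hook_span x -> hook_span (flip x).
Proof.
elim=> {x} [|x hx|x y _ hx _ hy|c x _ hx|x y _ hx _ hy].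
- rewrite flip0; exact: hook_span0.
- exact/hook_span_hook/is_hook_flip.
- by rewrite flipD; apply: hook_spanD.
- by rewrite flipZ; apply: hook_spanZ.
by rewrite tl_flip_comp; apply: hook_spanM.
Qed.

Lemma killsl_span n (f x : C n n) : killsl f -> hook_span x -> x ** f = 0.
Proof.
move=> kf; elim=> {x} [|x /kf//|x y _ hx _ hy|c x _ hx|x y _ hx _ hy].
- exact: comp0l.
- by rewrite compDl hx hy addr0.
- by rewrite compZl hx scaler0.
by rewrite -tl_compA hy comp0r.
Qed.

Lemma killsr_span n (f x : C n n) : killsr f -> hook_span x -> f ** x = 0.
Proof.
move=> kf; elim=> {x} [|x /kf//|x y _ hx _ hy|c x _ hx|x y _ hx _ hy].
- exact: comp0r.
- by rewrite compDr hx hy addr0.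
- by rewrite compZr hx scaler0.
by rewrite tl_compA hx comp0l.
Qed.

Lemma killsl_absorb n (f x : C n n) : killsl f -> hook_span (x - one n) -> x ** f = f.
Proof.
move=> kf /(killsl_span kf); rewrite compBl tl_comp1l => /eqP.
by rewrite subr_eq0 => /eqP.
Qed.

Lemma killsr_absorb n (f x : C n n) : killsr f -> hook_span (x - one n) -> f ** x = f.
Proof.
move=> kf /(killsr_span kf); rewrite compBr tl_comp1r => /eqP.
by rewrite subr_eq0 => /eqP.
Qed.

(** Both equal [f ** g]: a factor congruent to the identity modulo hooks is absorbed by whatever
    kills the hooks. *)
Lemma projector_unique n (f g : C n n) : killsr f -> hook_span (f - one n) ->
  killsl g -> hook_span (g - one n) -> f = g.
Proof.
by move=> kf hf kg hg; rewrite -[LHS](killsr_absorb kf hg) (killsl_absorb kg hf).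
Qed.

(** The rightmost strand of [x] is closed by an arc on its right, whose far side is the strand added
    by [wid]. *)
Definition ptrace n (x : C n.+1 n.+1) : C n n := cup n ** wid x ** cap n.

Lemma ptraceZ n c (x : C n.+1 n.+1) : ptrace (c *: x) = c *: ptrace x.
Proof. by rewrite /ptrace widZ compZr compZl. Qed.

Lemma ptrace_linear n : linear (@ptrace n).
Proof. by move=> c x y; rewrite /ptrace widD compDr compDl widZ compZr compZl. Qed.

Lemma ptrace_wid n (x : C n n) : ptrace (wid x) = d *: x.
Proof. by rewrite /ptrace -tl_cup_natural -tl_compA tl_cup_cap compZr tl_comp1r. Qed.

Lemma ptrace_wid_comp n (x z : C n n) y : ptrace (wid x ** y ** wid z) = x ** ptrace y ** z.
Proof.
rewrite /ptrace !tl_wid_comp !tl_compA -tl_cup_natural.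
by rewrite -!(tl_compA _ _ (cap n)) -tl_cap_natural !tl_compA.
Qed.

Lemma ptrace_last_hook n : ptrace (last_hook n) = one n.+1.
Proof.
rewrite /ptrace /last_hook tl_wid_comp tl_compA tl_cup_wid_cap tl_comp1l.
exact: tl_wid_cup_cap.
Qed.

Variable D : nat -> R.
Hypothesis D0 : D 0 = 1.
Hypothesis D1 : D 1 = d.
Hypothesis DSS : forall n, D n.+2 = d * D n.+1 - D n.
Hypothesis D_unit : forall n, D n \is a GRing.unit.

(** The coefficient is the inverse of the partial trace factor of [jw k.+1]; this makes the last
    hook annihilate the difference. *)
Definition wenzl n : C n n -> C n.+1 n.+1 :=
  match n return C n n -> C n.+1 n.+1 with
  | 0 => fun f => wid f
  | k.+1 => fun f => wid f - (D k / D k.+1) *: (wid f ** last_hook k ** wid f)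
  end.

Fixpoint jw n : C n n :=
  match n return C n n with 0 => one 0 | k.+1 => wenzl (jw k) end.

Lemma jwSS n : jw n.+2 = wid (jw n.+1) -
  (D n / D n.+1) *: (wid (jw n.+1) ** last_hook n ** wid (jw n.+1)).
Proof. by []. Qed.

Lemma jw1 : jw 1 = one 1.
Proof. exact: tl_wid1. Qed.

(** The facts need one another in the induction: the partial trace of [jw n.+1] computes its product
    between two last hooks, this gives the killing at [n.+2], and the partial trace at [n.+2] uses
    idempotence at [n.+1], a consequence of killing. *)
Definition jw_spec n :=
  [/\ killsl (jw n.+1), killsr (jw n.+1), hook_span (jw n.+1 - one n.+1),
      hook_span (jw n - one n)
    & ptrace (jw n.+1) = (D n.+1 / D n) *: jw n].

Lemma jw_specP n : jw_spec n.
Proof.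
elim: n => [|n [kl kr hf hf0 trf]].
  rewrite /jw_spec jw1 /= !subrr; split; try exact: hook_span0.
  - by move=> e /= [[]|].
  - by move=> e /= [[]|].
  - by rewrite /ptrace tl_wid1 tl_comp1r tl_cup_cap D0 D1 divr1.
set f := jw n.+1 in kl kr hf trf *; set F := wid f.
have [E EE] : exists E, E = last_hook n by exists (last_hook n).
set c := D n / D n.+1.
have c_unit : c \is a GRing.unit by rewrite unitrMl ?unitrV ?D_unit.
have cV : D n.+1 / D n = c^-1 by rewrite /c invrM ?unitrV ?D_unit // invrK.
have c1 : c * c^-1 = 1 by rewrite mulrV.
have hF : hook_span (F - one n.+2) by rewrite -tl_wid1 -widB; apply: hook_span_wid.
(* The facing arcs of the two hooks close the last strand of [f], so its partial trace appears in
   the middle. *)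
have EFE : E ** F ** E = c^-1 *: (cap n ** jw n ** cup n).
  rewrite EE /last_hook -cV -compZl -compZr -trf /ptrace.
  by rewrite !tl_compA.
have jwf : wid (jw n) ** f = f.
  by apply: killsl_absorb kl _; rewrite -tl_wid1 -widB; apply: hook_span_wid.
have fjw : f ** wid (jw n) = f.
  by apply: killsr_absorb kr _; rewrite -tl_wid1 -widB; apply: hook_span_wid.
(* [jw n] slides past [cup n] and is absorbed by [f]. *)
have EFEF : c *: (E ** F ** E ** F) = E ** F.
  rewrite EFE compZl scalerA c1 scale1r -(tl_compA _ _ (cup n)) tl_cup_natural.
  by rewrite -!tl_compA -tl_wid_comp jwf tl_compA EE.
have FEFE : c *: (F ** E ** F ** E) = F ** E.
  have -> : F ** E ** F ** E = F ** (E ** F ** E) by rewrite !tl_compA.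
  rewrite EFE compZr scalerA c1 scale1r tl_cap_natural.
  by rewrite !tl_compA -tl_wid_comp fjw -tl_compA EE.
have kl2 : killsl (jw n.+2).
  move=> e; rewrite jwSS -/f -/F -EE -/c => -[[y hy ->]|->]; rewrite -?EE.
    have yF : wid y ** F = 0 by rewrite -tl_wid_comp kl // wid0.
    by rewrite compBr compZr !tl_compA yF !comp0l scaler0 subrr.
  by rewrite compBr compZr !tl_compA EFEF subrr.
have kr2 : killsr (jw n.+2).
  move=> e; rewrite jwSS -/f -/F -EE -/c => -[[y hy ->]|->]; rewrite -?EE.
    have yF : F ** wid y = 0 by rewrite -tl_wid_comp kr // wid0.
    by rewrite compBl compZl -!tl_compA yF !comp0r scaler0 subrr.
  by rewrite compBl compZl FEFE subrr.
split=> //.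
- rewrite jwSS -/f -/F -EE addrAC; apply: hook_spanB => //; apply: hook_spanZ.
  have hE : hook_span E by apply: hook_span_hook; right; rewrite EE.
  have hEF : hook_span (E ** F).
    rewrite -[F](subrK (one _)) compDr tl_comp1r; apply: hook_spanD => //.
    exact: hook_spanM.
  rewrite -tl_compA -[X in X ** _](subrK (one _)) compDl tl_comp1l.
  by apply: hook_spanD => //; apply: hook_spanM.
(* The trace of [wid f] contributes [d]; the correction contributes [c], as the partial trace of a
   last hook is the identity. [DSS] turns [d - c] into [D n.+2 / D n.+1]. *)
rewrite jwSS -/f -/F -EE -/c; have [_ _ + _] := linear_form (@ptrace_linear n.+1).
move=> ->; rewrite ptraceZ ptrace_wid ptrace_wid_comp EE ptrace_last_hook tl_comp1r.
have -> : f ** f = f by apply: killsl_absorb.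
by rewrite -scalerBl /c DSS mulrBl mulrK ?D_unit.
Qed.

Lemma jw_killsl n : killsl (jw n).
Proof. by case: n => [|n]; [move=> e []|have [] := jw_specP n]. Qed.

Lemma jw_killsr n : killsr (jw n).
Proof. by case: n => [|n]; [move=> e []|have [] := jw_specP n]. Qed.

Lemma jw_hook_span n : hook_span (jw n - one n).
Proof. by have [] := jw_specP n. Qed.

Lemma ptrace_jw n : ptrace (jw n.+1) = (D n.+1 / D n) *: jw n.
Proof. by have [] := jw_specP n. Qed.

Lemma jw_idem n : jw n ** jw n = jw n.
Proof. exact: killsl_absorb (@jw_killsl n) (@jw_hook_span n). Qed.

Lemma hook_span_wid1 n (x : C n n) : hook_span (x - one n) -> hook_span (wid x - one n.+1).
Proof. by rewrite -tl_wid1 -widB; apply: hook_span_wid. Qed.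

Lemma wid_jw_absorbl n : wid (jw n) ** jw n.+1 = jw n.+1.
Proof. exact: killsl_absorb (@jw_killsl _) (hook_span_wid1 (@jw_hook_span n)). Qed.

(** Reflection maps hooks to hooks, so the reflected projector satisfies the same characterization
    and uniqueness applies. *)
Lemma flip_jw n : flip (jw n) = jw n.
Proof.
apply: projector_unique (@jw_killsl n) (@jw_hook_span n).
  move=> e he; rewrite -[e](@tl_flipK _ _ C) -tl_flip_comp jw_killsl ?flip0 //.
  exact: is_hook_flip.
by rewrite -[one n]tl_flip1 -flipB; apply/hook_span_flip/jw_hook_span.
Qed.

Fixpoint closure n : C n n -> R :=
  match n return C n n -> R with
  | 0 => @tl_eval _ _ C
  | k.+1 => fun x => closure (ptrace x)
  end.

Lemma closure_linear n c (x y : C n n) :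
  closure (c *: x + y) = c * closure x + closure y.
Proof.
by elim: n x y => [|n IHn] x y /=; [exact: tl_eval_linear|rewrite ptrace_linear IHn].
Qed.

Lemma closure0 n : closure (0 : C n n) = 0.
Proof.
have := closure_linear 1 (0 : C n n) 0; rewrite scaler0 addr0 mul1r.
by rewrite -{1}[closure 0]addr0 => /addrI <-.
Qed.

Lemma closureZ n c (x : C n n) : closure (c *: x) = c * closure x.
Proof. by rewrite -[c *: x]addr0 closure_linear closure0 addr0. Qed.

Lemma closure_jw n : closure (jw n) = D n.
Proof.
elim: n => [|n IHn]; first by rewrite /= tl_eval1 D0.
by rewrite [LHS]/= -/(jw n.+1) ptrace_jw closureZ IHn mulrVK ?D_unit.
Qed.

(** * The reduced Gram matrix *)

Definition down n h (x : C n h.+1) : C n.+1 h := wid x ** cap h.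

(** A path is read from its last step: an up-step adds a through strand, a down-step joins the new
    strand to the rightmost open one. With ordinals as indices, the two kinds of last step become
    the two blocks of the Gram matrix. *)
Fixpoint path_basis n : forall h, 'I_(npaths n h) -> C n h :=
  match n return forall h, 'I_(npaths n h) -> C n h with
  | 0 => fun h => match h return 'I_(npaths 0 h) -> C 0 h with
         | 0 => fun _ => one 0
         | _.+1 => fun _ => 0
         end
  | n'.+1 => fun h => match h return 'I_(npaths n'.+1 h) -> C n'.+1 h with
         | 0 => fun i => @down n' 0 (@path_basis n' 1%N i)
         | h'.+1 => fun i => match @fintype.split (npaths n' h') (npaths n' h'.+2) i with
                             | inl j => wid (@path_basis n' h' j)
                             | inr j => @down n' h'.+1 (@path_basis n' h'.+2 j)
                             end
         end
  end.

(** The geometric input beyond the axioms of the record. It is stated after composing with [f]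
    because diagrams with an arc between two top points are killed by [f], and the others are the
    [path_basis] elements up to powers of [d]. *)
Hypothesis span : forall n h (f : C h h), killsl f -> forall x : C n h,
  exists c : 'I_(npaths n h) -> R, x ** f = \sum_i c i *: (path_basis i ** f).

Lemma npaths_small n h : (n < h)%N -> npaths n h = 0%N.
Proof. by elim: n h => [|n IHn] [|h] //= nh; rewrite !IHn //; lia. Qed.

(** No path of [n] steps climbs above [n], so the spanning family is empty. *)
Lemma jw_kills_growing n h (x : C n h) : (n < h)%N -> x ** jw h = 0.
Proof.
move=> /npaths_small n0; have [c ->] := span (@jw_killsl h) x.
by apply: big1 => -[i i0]; exfalso; rewrite n0 in i0.
Qed.

Lemma path_basis_diag n (i : 'I_(npaths n n)) : path_basis i = one n.
Proof.
elim: n i => [//|n IHn] i /=; case: fintype.splitP => j _; first by rewrite IHn tl_wid1.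
by case: j => j j0; exfalso; rewrite npaths_small ?leqnSn in j0.
Qed.

(** The path of [h] steps up to [h] never goes down, hence gives the identity. *)
Lemma jw_sandwich h (x : C h h) : exists c, x ** jw h = c *: jw h.
Proof.
have [c ->] := span (@jw_killsl h) x; exists (\sum_i c i); rewrite scaler_suml.
by apply: eq_bigr => i _; rewrite path_basis_diag tl_comp1l.
Qed.

Definition form n h (x y : C n h) : R := closure (flip (y ** jw h) ** (x ** jw h)).
Definition rform n h (x y : C n h) : R := form x y / D h.

Lemma formE n h (x y : C n h) : form x y = rform x y * D h.
Proof. by rewrite mulrVK ?D_unit. Qed.

(** [form x y] is the closure of [jw h ** (c *: jw h)], and [jw h] closes to the unit [D h]. *)
Lemma rform_eq n h (x y : C n h) c : flip y ** x ** jw h = c *: jw h -> rform x y = c.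
Proof.
move=> Ec; rewrite /rform /form tl_flip_comp flip_jw -!tl_compA (tl_compA (flip y)).
by rewrite Ec compZr jw_idem closureZ closure_jw mulrK ?D_unit.
Qed.

Lemma rformP n h (x y : C n h) : flip y ** x ** jw h = rform x y *: jw h.
Proof. by have [c Ec] := jw_sandwich (flip y ** x); rewrite Ec (rform_eq Ec). Qed.

Lemma rform_congr n h (x x' y y' : C n h) :
  x ** jw h = x' ** jw h -> y ** jw h = y' ** jw h -> rform x y = rform x' y'.
Proof. by rewrite /rform /form => -> ->. Qed.

Lemma rform_linearl n h (y : C n h) : linear (fun x => rform x y : R^o).
Proof.
move=> c x x'; rewrite /rform /form compDl compDr compZl compZr closure_linear.
by rewrite mulrDl -mulrA.
Qed.

Lemma rform_linearr n h (x : C n h) : linear (fun y => rform x y : R^o).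
Proof.
move=> c y y'; rewrite /rform /form compDl flipD compDl compZl flipZ compZl.
by rewrite closure_linear mulrDl -mulrA.
Qed.

Lemma linear_sum (V W : lmodType R) (f : V -> W) (I : finType) (c : I -> R) (x : I -> V) :
  linear f -> f (\sum_i c i *: x i) = \sum_i c i *: f (x i).
Proof.
move=> /linear_form[f0 fD _ fZ]; rewrite (big_morph f fD f0).
by apply: eq_bigr => i _; rewrite fZ.
Qed.

(** [jw h.+1] absorbs [wid (jw h)], which can thus be inserted to reduce the claim to [h]. *)
Lemma rform_wid n h (x y : C n h) : rform (wid x) (wid y) = rform x y.
Proof.
apply: rform_eq; rewrite tl_flip_wid -tl_wid_comp -[in LHS]wid_jw_absorbl tl_compA.
by rewrite -tl_wid_comp rformP widZ compZl wid_jw_absorbl.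
Qed.

(** Gluing the two [down] elements along the bottom gives the partial trace of a multiple of
    [jw h.+1]; the factor is that of [ptrace_jw]. *)
Lemma rform_down n h (x y : C n h.+1) :
  rform (down (x ** jw h.+1)) (down (y ** jw h.+1)) = (D h.+1 / D h) * rform x y.
Proof.
apply: rform_eq; rewrite /down tl_flip_comp tl_flip_wid tl_flip_cap.
have -> : cup h ** wid (flip (y ** jw h.+1)) ** (wid (x ** jw h.+1) ** cap h) =
          ptrace (flip (y ** jw h.+1) ** (x ** jw h.+1)).
  by rewrite /ptrace (tl_wid_comp (flip (y ** _))) !tl_compA.
have -> : flip (y ** jw h.+1) ** (x ** jw h.+1) = rform x y *: jw h.+1.
  rewrite tl_flip_comp flip_jw -!tl_compA (tl_compA (flip y)) rformP compZr.
  by rewrite jw_idem.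
by rewrite ptraceZ ptrace_jw scalerA compZl jw_idem mulrC.
Qed.

(** The composite contains a map from [h] to [h.+2] points followed by [jw h.+2], which vanishes. *)
Lemma rform_down_wid n h (x : C n h.+2) (y : C n h) :
  rform (down (x ** jw h.+2)) (wid y) = 0.
Proof.
apply: rform_eq; rewrite /down tl_flip_wid !tl_compA -tl_wid_comp tl_compA.
by rewrite (@jw_kills_growing h h.+2) ?leqnSn // wid0 !comp0l scale0r.
Qed.

Lemma rform_wid_down n h (x : C n h) (y : C n h.+2) :
  rform (wid x) (down (y ** jw h.+2)) = 0.
Proof.
apply: rform_eq; rewrite /down tl_flip_comp tl_flip_wid tl_flip_cap.
rewrite -(tl_compA (cup _)) -tl_wid_comp tl_flip_comp flip_jw.
have -> : jw h.+2 ** flip y ** x = 0.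
  rewrite -tl_compA -[LHS]tl_flipK tl_flip_comp flip_jw.
  by rewrite (@jw_kills_growing h h.+2) ?leqnSn // flip0.
by rewrite wid0 comp0r comp0l scale0r.
Qed.

(* Replacing [x] by its projection only adds to [down x] elements coming from
   one strand less: this is Wenzl's recursion together with a zigzag. *)
Lemma down_jw n h (x : C n h.+2) : exists c : 'I_(npaths n h) -> R,
  down (x ** jw h.+2) ** jw h.+1 =
    (down x + \sum_i c i *: wid (path_basis i)) ** jw h.+1.
Proof.
have [f Ef] : exists f, f = jw h.+1 by exists (jw h.+1).
have [F EF] : exists F, F = wid f by exists (wid f).
have [H EH] : exists H, H = last_hook h by exists (last_hook h).
(* The correction term straightens to [wid] of this element, followed by [f]. Since [f] absorbs
   [wid (jw h)], an expansion modulo [jw h] is enough. *)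
have [c Ec] := span (@jw_killsl h) (- (D h / D h.+1) *: (x ** F ** cap h)).
exists c; rewrite /down jwSS -Ef -EF -EH compBr compZr widB widZ compBl compZl.
have FC : wid F ** cap h.+1 = cap h.+1 ** f by rewrite EF -tl_cap_natural.
have ff : f ** f = f by rewrite Ef jw_idem.
have wf : wid (jw h) ** f = f by rewrite Ef wid_jw_absorbl.
have -> : wid (x ** F) ** cap h.+1 = wid x ** cap h.+1 ** f.
  by rewrite tl_wid_comp -!tl_compA FC.
have -> : wid (x ** (F ** H ** F)) ** cap h.+1 = wid (x ** F ** cap h) ** f.
  have zz : wid H ** cap h.+1 = wid (cap h).
    by rewrite EH /last_hook tl_wid_comp -tl_compA tl_wid_cup_cap tl_comp1r.
  rewrite !tl_wid_comp -!tl_compA FC.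
  by rewrite (tl_compA (wid H)) zz.
rewrite compBl compZl -!(tl_compA _ f f) ff compDl; congr (_ + _).
rewrite -scaleNr -compZl -widZ -[in LHS]wf tl_compA -tl_wid_comp Ec.
rewrite (linear_sum _ _ (@tl_wid_linear _ _ C _ _)).
rewrite !(linear_sum _ _ (tl_comp_linearl f)).
by apply: eq_bigr => i _; rewrite tl_wid_comp -tl_compA wf.
Qed.

Definition gram n h := \matrix_(i, j) rform (@path_basis n h i) (@path_basis n h j).

(** Expansions are asked for only after [jw h], because the form sees no more; [down_jw] provides
    them in this shape. *)
Lemma gram_mul n h m1 m2 (P : 'M[R]_(m1, npaths n h)) (Q : 'M[R]_(m2, npaths n h))
    (x : 'I_m1 -> C n h) (y : 'I_m2 -> C n h) :
  (forall i, x i ** jw h = (\sum_k P i k *: path_basis k) ** jw h) ->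
  (forall j, y j ** jw h = (\sum_k Q j k *: path_basis k) ** jw h) ->
  \matrix_(i, j) rform (x i) (y j) = P *m gram n h *m Q^T.
Proof.
move=> Ex Ey; apply/matrixP => i j; rewrite !mxE (rform_congr (Ex i) (Ey j)).
rewrite (linear_sum _ _ (rform_linearl _)) /=.
under eq_bigr do rewrite (linear_sum _ _ (rform_linearr _)) /=.
under [RHS]eq_bigr do rewrite !mxE big_distrl /=.
rewrite exchange_big /=; apply: eq_bigr => k _; rewrite scaler_sumr.
apply: eq_bigr => l _; rewrite !mxE.
by rewrite /GRing.scale /= mulrCA [RHS]mulrC.
Qed.

Lemma det_gram0 h : \det (gram 0 h) = 1.
Proof.
case: h => [|h]; last exact: det_mx00.
rewrite [gram 0 0](_ : _ = 1%:M) ?det1 //; apply/matrixP => i j.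
rewrite !mxE !ord1 eqxx /=; apply: rform_eq.
by rewrite tl_flip1 tl_comp1l tl_comp1l scale1r.
Qed.

(** A path ending at 0 ends with a down-step, and [jw 1] is the identity, so the basis needs no
    change here. *)
Lemma det_gramS0 n :
  \det (gram n.+1 0) = (D 1 / D 0) ^+ npaths n 1 * \det (gram n 1).
Proof.
rewrite -detZ; congr (\det _); apply/matrixP => i j; rewrite !mxE /=.
by rewrite -rform_down jw1 !tl_comp1r.
Qed.

Local Arguments npaths : simpl never.
Local Arguments jw : simpl never.

Lemma det_gramSS n h : \det (gram n.+1 h.+1) = \det (gram n h) *
  ((D h.+2 / D h.+1) ^+ npaths n h.+2 * \det (gram n h.+2)).
Proof.
have /fin_all_exists[L EL] i := @down_jw n h (path_basis (n := n) (h := h.+2) i).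
(* [P] holds the coordinates of the modified family [w], with the corrections of [down_jw] in the
   lower left block. *)
pose P : 'M[R]_(npaths n.+1 h.+1) := block_mx 1%:M 0 (\matrix_(i, k) L i k) 1%:M.
pose w (i : 'I_(npaths n.+1 h.+1)) : C n.+1 h.+1 :=
  match fintype.split i with
  | inl j => wid (path_basis (n := n) (h := h) j)
  | inr j => down (path_basis (n := n) (h := h.+2) j ** jw h.+2)
  end.
have bl (k : 'I_(npaths n h)) :
    @path_basis n.+1 h.+1 (lshift (npaths n h.+2) k) = wid (path_basis k).
  by rewrite /= (unsplitK (inl k)).
have br (k : 'I_(npaths n h.+2)) :
    @path_basis n.+1 h.+1 (rshift (npaths n h) k) = down (path_basis k).
  by rewrite /= (unsplitK (inr k)).
have sumE i : \sum_k P i k *: path_basis k =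
    \sum_(k < npaths n h) P i (lshift (npaths n h.+2) k) *: wid (path_basis k) +
    \sum_(k < npaths n h.+2) P i (rshift (npaths n h) k) *: down (path_basis k).
  rewrite (@big_split_ord _ _ _ (npaths n h) (npaths n h.+2)).
  by congr (_ + _); apply: eq_bigr => k _; rewrite ?bl ?br.
have Ew i : w i ** jw h.+1 = (\sum_k P i k *: path_basis k) ** jw h.+1.
  rewrite sumE -[i](@fintype.splitK (npaths n h) (npaths n h.+2)) /w unsplitK.
  case: (@fintype.split (npaths n h) (npaths n h.+2) i) => j /=.
    rewrite [X in _ + X]big1 ?addr0 => [|k _]; last by rewrite block_mxEur mxE scale0r.
    rewrite (bigD1 j) //= big1 ?addr0 => [|k kj]; last first.
      by rewrite block_mxEul mxE eq_sym (negPf kj) scale0r.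
    by rewrite block_mxEul mxE eqxx scale1r.
  rewrite EL addrC; congr ((_ + _) ** _).
    by apply: eq_bigr => k _; rewrite block_mxEdl mxE.
  rewrite (bigD1 j) //= big1 ?addr0 => [|k kj]; last first.
    by rewrite block_mxEdr mxE eq_sym (negPf kj) scale0r.
  by rewrite block_mxEdr mxE eqxx scale1r.
have EW := gram_mul Ew Ew.
have EWb : \matrix_(i, j) rform (w i) (w j) =
    block_mx (gram n h) 0 0 ((D h.+2 / D h.+1) *: gram n h.+2).
  apply/matrixP => i j; rewrite mxE -[i](@fintype.splitK (npaths n h) (npaths n h.+2)).
  rewrite -[j](@fintype.splitK (npaths n h) (npaths n h.+2)) /w !unsplitK.
  case: (@fintype.split (npaths n h) (npaths n h.+2) i) => k;
    case: (@fintype.split (npaths n h) (npaths n h.+2) j) => l /=.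
  - by rewrite block_mxEul mxE rform_wid.
  - by rewrite block_mxEur mxE rform_wid_down.
  - by rewrite block_mxEdl mxE rform_down_wid.
  by rewrite block_mxEdr !mxE rform_down.
have detP : \det P = 1 by rewrite det_lblock !det1 mulr1.
by rewrite -detZ -(det_ublock _ 0) -EWb EW !det_mulmx det_tr detP mul1r mulr1.
Qed.

Lemma det_form n h :
  \det (\matrix_(i, j) form (@path_basis n h i) (@path_basis n h j)) =
  D h ^+ npaths n h * \det (gram n h).
Proof.
rewrite -detZ; congr (\det _); apply/matrixP => i j; rewrite !mxE.
by rewrite formE mulrC.
Qed.

(* [ndown k n h] is the number of steps from [k] down to [k.-1] in the paths
   counted by [npaths n h]. *)
Fixpoint ndown k n h : nat :=
  match n, h with
  | 0, _ => 0%N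
  | n'.+1, 0 => ((k == 1%N) * npaths n' 1%N + ndown k n' 1%N)%N
  | n'.+1, h'.+1 =>
      (ndown k n' h' + ((k == h'.+2) * npaths n' h'.+2 + ndown k n' h'.+2))%N
  end.

(** [K] is a free bound so that the induction hypotheses at [h] and [h.+2] share one product range.
    Inside, [peel] spreads a single factor over that range by an indicator exponent. *)
Lemma det_gram n h K : (n + h < K)%N ->
  \det (gram n h) = \prod_(1 <= k < K) (D k / D k.-1) ^+ ndown k n h.
Proof.
have peel k N : (0 < k < K)%N ->
    (D k / D k.-1) ^+ N = \prod_(1 <= l < K) (D l / D l.-1) ^+ ((l == k) * N).
  move=> k0; rewrite (bigD1_seq k) ?mem_index_iota ?iota_uniq //= eqxx mul1n.
  by rewrite big1 ?mulr1 // => l /negPf ->; rewrite expr0.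
elim: n h => [|n IHn] [|h] nK.
- by rewrite det_gram0 big1.
- by rewrite det_gram0 big1.
- rewrite det_gramS0 (peel 1%N) ?IHn; try lia.
  by rewrite -big_split; apply: eq_bigr => k _ /=; rewrite exprD.
rewrite det_gramSS (peel h.+2) ?IHn; try lia.
by rewrite -!big_split; apply: eq_bigr => k _ /=; rewrite !exprD.
Qed.
End TemperleyLieb.

(** * Counting paths *)

(** The lower index is doubled: Pascal's rule shifts [x] by 2, and odd [x] follows the convention of
    the theorem for fractional entries. *)
Definition half_bin n x : nat := if odd x then 0%N else 'C(n, x./2).

Lemma half_binS n x y : x = y.+2 -> half_bin n.+1 x = (half_bin n x + half_bin n y)%N.
Proof. by move=> ->; rewrite /half_bin /= negbK; case: odd => //; rewrite binS. Qed.

(** Symmetry of the two middle binomials; this is the boundary condition for paths ending at height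
    0. *)
Lemma half_bin_mid n : half_bin n.+1 n.+1 = (half_bin n n.+1 + half_bin n n.+1)%N.
Proof.
have [no|ne] := boolP (odd n); last by rewrite /half_bin /= ne.
have [m ->] : exists m, n = m.*2.+1.
  by exists n./2; rewrite -[LHS]odd_double_half no.
rewrite (@half_binS _ _ m.*2) // /half_bin.
have -> : odd m.*2.+2 = false by lia.
have -> : odd m.*2 = false by lia.
have -> : m.*2.+2./2 = m.+1 by lia.
have -> : m.*2./2 = m by lia.
by rewrite -[in 'C(_, m)]bin_sub; [congr (_ + 'C(_, _))%N|]; lia.
Qed.

Lemma half_bin_big n x : (2 * n < x)%N -> half_bin n x = 0%N.
Proof. by move=> nx; rewrite /half_bin; case: ifP => // xo; rewrite bin_small //; lia. Qed.

(** Ballot numbers: the right side counts all walks from 0 to [h] on the integers, and the term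
    added on the left counts, by reflection, those that reach -1. A sum avoids truncated
    subtraction. *)
Lemma npathsE n h : (npaths n h + half_bin n (n + h).+2 = half_bin n (n + h))%N.
Proof.
elim: n h => [|n IHn] [|h].
- by [].
- by rewrite !half_bin_big.
- have := IHn 1%N; rewrite [npaths n.+1 0]/= !addn0 addn1.
  by rewrite (@half_binS n n.+3 n.+1) // half_bin_mid; lia.
have := IHn h; have := IHn h.+2; rewrite [npaths n.+1 _]/= !addSn !addnS.
by rewrite (@half_binS n (n + h).+4 (n + h).+2) // (@half_binS n (n + h).+2 (n + h)) //; lia.
Qed.

(** At positive height, the cases of [k] against [h.+1] are those in which the minima simplify. New
    down-steps contribute only on equality, where [npathsE] makes up for the jump of the minimum. *)
Lemma ndownE k n h :
  (ndown k.+1 n h + half_bin n (n + h + 2 * k).+4 =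
   half_bin n (n + h + 2 * k - 2 * minn k h).+2)%N.
Proof.
elim: n h => [|n IHn] [|h]; try by rewrite !half_bin_big //; lia.
  have := IHn 1%N; have := npathsE n 1; rewrite [ndown _ n.+1 _]/=.
  rewrite minn0 subn0 addn0 addn1.
  rewrite (@half_binS n (n.+1 + 2 * k).+4 (n.+1 + 2 * k).+2) //.
  rewrite (@half_binS n (n.+1 + 2 * k).+2 (n.+1 + 2 * k)) //.
  case: k {IHn} => [|k]; first by rewrite min0n muln0 subn0 addn0 eqxx mul1n; lia.
  have -> : (n.+1 + 2 * k.+1 - 2 * minn k.+1 1).+2 = (n.+1 + 2 * k.+1)%N by lia.
  have -> : (k.+2 == 1%N) = false by [].
  by rewrite mul0n; lia.
have := IHn h; have := IHn h.+2; have := npathsE n h.+2.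
rewrite [ndown _ n.+1 _]/= eqSS.
rewrite (@half_binS n (n.+1 + h.+1 + 2 * k).+4 (n.+1 + h.+1 + 2 * k).+2) //.
rewrite (@half_binS n _ (n.+1 + h.+1 + 2 * k - 2 * minn k h.+1)) //.
have -> : (n + h.+2 + 2 * k).+4 = (n + h + 2 * k).+4.+2 by lia.
have -> : (n.+1 + h.+1 + 2 * k).+4 = (n + h + 2 * k).+4.+2 by lia.
have -> : (n.+1 + h.+1 + 2 * k).+2 = (n + h + 2 * k).+4 by lia.
rewrite (addnS n h.+1) (addnS n h).
have [kh|hk|->] := ltngtP k h.+1; rewrite ?mul0n ?mul1n.
- have -> : (n.+1 + h.+1 + 2 * k - 2 * k).+2 = (n + h).+4 by lia.
  have -> : (n.+1 + h.+1 + 2 * k - 2 * k)%N = (n + h).+2 by lia.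
  have -> : ((n + h).+2 + 2 * k - 2 * minn k h.+2).+2 = (n + h).+4 by lia.
  have -> : (n + h + 2 * k - 2 * minn k h).+2 = (n + h).+2 by lia.
  by lia.
- have -> : (n.+1 + h.+1 + 2 * k - 2 * h.+1)%N = (n + 2 * k - h)%N by lia.
  have -> : ((n + h).+2 + 2 * k - 2 * minn k h.+2).+2 = (n + 2 * k - h)%N by lia.
  have -> : (n + h + 2 * k - 2 * minn k h).+2 = (n + 2 * k - h).+2 by lia.
  by lia.
have -> : (n.+1 + h.+1 + 2 * h.+1 - 2 * h.+1).+2 = (n + h).+4 by lia.
have -> : (n.+1 + h.+1 + 2 * h.+1 - 2 * h.+1)%N = (n + h).+2 by lia.
have -> : ((n + h).+2 + 2 * h.+1 - 2 * minn h.+1 h.+2).+2 = (n + h).+4 by lia.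
have -> : (n + h + 2 * h.+1 - 2 * minn h.+1 h).+2 = (n + h).+4 by lia.
by lia.
Qed.

Definition adjacent (x y : nat) := (x == y.+1) || (y == x.+1).

Fixpoint path_seqs n h : seq (seq nat) :=
  match n, h with
  | 0, 0 => [:: [::]]
  | 0, _.+1 => [::]
  | n'.+1, 0 => [seq rcons a 0%N | a <- path_seqs n' 1%N]
  | n'.+1, h'.+1 =>
      [seq rcons a h | a <- path_seqs n' h'] ++ [seq rcons a h | a <- path_seqs n' h'.+2]
  end.

Lemma size_path_seqs n h : size (path_seqs n h) = npaths n h.
Proof.
by elim: n h => [|n IHn] [|h] //=; rewrite ?size_cat !size_map !IHn.
Qed.

Lemma mem_map_rcons (a : seq nat) x h s :
  (rcons a x \in [seq rcons b h | b <- s]) = (x == h) && (a \in s).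
Proof.
apply/mapP/andP => [[b bs /rcons_inj[-> ->]]|[/eqP-> as_]]; first by rewrite eqxx.
by exists a.
Qed.

(** An implicit height 0 precedes the sequence; its only neighbour is 1, in agreement with the
    prescribed first entry in [D_paths]. *)
Lemma mem_path_seqs n h a :
  (a \in path_seqs n h) = [&& size a == n, path adjacent 0 a & last 0 a == h]%N.
Proof.
elim: n h a => [|n IHn] h a; first by case: h => [|h]; case: a.
case: (lastP a) => [|{}a x].
  case: h => [|h] /=; rewrite ?mem_cat; apply/negP; rewrite ?negb_or.
    by case/mapP=> [[]].
  by case/orP; case/mapP=> [[]].
rewrite size_rcons eqSS rcons_path last_rcons.
case: h => [|h] /=; rewrite ?mem_cat !mem_map_rcons !IHn /adjacent.
  by have [->|] := eqVneq x 0%N; rewrite ?andbF //= andbT orbF.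
have [->|] := eqVneq x h.+1; rewrite ?andbF //= andbT eqSS.
by case: (size a == n) => //=; case: path => //=; rewrite (eq_sym h) orbC.
Qed.

Lemma path_seqs_uniq n h : uniq (path_seqs n h).
Proof.
have ri l : injective (rcons^~ l : seq nat -> _) by move=> a b /rcons_inj[].
elim: n h => [|n IHn] [|h] //=; first by rewrite map_inj_uniq.
rewrite cat_uniq !map_inj_uniq // !IHn andbT /=; apply/hasPn => _ /mapP[a + ->].
rewrite mem_map_rcons eqxx /= !mem_path_seqs => /and3P[_ _ /eqP->].
by rewrite (gtn_eqF (leqnSn h.+1)) !andbF.
Qed.

(** * Classes of words *)

Lemma malg_sumE (R : nzRingType) (K : choiceType) (x : {malg R[K]}) :
  x = \sum_(k <- msupp x) x@_k *: << k >>.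
Proof.
rewrite {1}[x]monalgE; apply: eq_bigr => k _.
by apply/malgP => l; rewrite mcoeffZ !mcoeffU mulr_natr.
Qed.

Lemma skein_ind n m (P : skein n m -> Prop) :
  P 0 -> (forall x y, P x -> P y -> P (x + y)) ->
  (forall c x, P x -> P (c *: x)) ->
  (forall t : tangle n m, P (skein_class t)) -> forall x, P x.
Proof.
move=> P0 PD PZ Pt x; elim/quotW: x => x.
rewrite [x]malg_sumE; elim: (finmap.enum_fset (msupp x)) => [|k s IHs].
  by rewrite big_nil; have -> : \pi_(skein n m) 0 = 0 by rewrite raddf0.
by rewrite big_cons pi_skeinP; apply: PD => //; apply/PZ/Pt.
Qed.

Lemma lin_bracket (U V : lmodType Lambda) (f : U -> V) c d x y z : linear f ->
  f (x - c *: y - d *: z) = f x - c *: f y - d *: f z.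
Proof. by move=> fl; rewrite (linB fl) (linB fl x) (linZ fl c) (linZ fl d). Qed.

(** Lets words be cut and rewritten freely: fitting becomes a side condition on [target], which also
    excludes the default value 0. *)
Definition cls n m (w : seq layer) : skein n m :=
  oapp (@skein_class n m) 0 (insub w).

Lemma clsE n m (t : tangle n m) : cls n m t = skein_class t.
Proof. by rewrite /cls valK. Qed.

Lemma cls_cat n k m (t : tangle n k) (u : tangle k m) :
  cls n m (t ++ u) = skein_class (cat_tangle t u).
Proof. exact: clsE (cat_tangle t u). Qed.

Lemma cls_cat3 n k l m (t : tangle n k) (u : tangle k l) (v : tangle l m) :
  cls n m (t ++ u ++ v) = skein_class (cat_tangle (cat_tangle t u) v).
Proof. by rewrite catA; exact: clsE (cat_tangle (cat_tangle t u) v). Qed.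

Lemma target_tangle n m w : target n w = Some m -> {t : tangle n m | layers t = w}.
Proof. by move=> /eqP nw; exists (Tangle nw). Qed.

Lemma tangle_target n m (t : tangle n m) : target n t = Some m.
Proof. by case: t => w /= /eqP. Qed.

Lemma skein_word_ind n m (P : skein n m -> Prop) :
  P 0 -> (forall x y, P x -> P y -> P (x + y)) ->
  (forall c x, P x -> P (c *: x)) ->
  (forall w, target n w = Some m -> P (cls n m w)) -> forall x, P x.
Proof.
move=> P0 PD PZ Pt; apply: skein_ind => // t; rewrite -clsE.
exact/Pt/tangle_target.
Qed.

Lemma linear_eq n m (V : lmodType Lambda) (f g : skein n m -> V) :
  linear f -> linear g ->
  (forall w, target n w = Some m -> f (cls n m w) = g (cls n m w)) ->
  forall x, f x = g x.
Proof.
move=> fl gl fg; apply: skein_word_ind => // [|x y Ex Ey|c x Ex].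
- by rewrite !lin0.
- by rewrite !linD // Ex Ey.
- by rewrite !linZ // Ex.
Qed.

Lemma stack_class n k m (t : tangle n k) (u : tangle k m) :
  stack (skein_class t) (skein_class u) = skein_class (cat_tangle t u).
Proof. by rewrite /skein_class pi_stack formal_cat1. Qed.

Lemma stack_cls n k m w w' : target n w = Some k -> target k w' = Some m ->
  stack (cls n k w) (cls k m w') = cls n m (w ++ w').
Proof.
move=> /target_tangle[t <-] /target_tangle[u <-].
by rewrite !clsE stack_class -clsE.
Qed.

Lemma stackDl n k m (x y : skein n k) (z : skein k m) :
  stack (x + y) z = stack x z + stack y z.
Proof. exact: (linD (stack_linearl z)). Qed.

Lemma stackZl n k m c (x : skein n k) (z : skein k m) :
  stack (c *: x) z = c *: stack x z.
Proof. exact: (linZ (stack_linearl z)). Qed.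

Lemma stackZr n k m c (x : skein n k) (y : skein k m) :
  stack x (c *: y) = c *: stack x y.
Proof. exact: (linZ (stack_linearr x)). Qed.

Lemma stack0l n k m (z : skein k m) : stack (0 : skein n k) z = 0.
Proof. exact: (lin0 (stack_linearl z)). Qed.

Lemma stack0r n k m (x : skein n k) : stack x (0 : skein k m) = 0.
Proof. exact: (lin0 (stack_linearr x)). Qed.

Lemma target_catP n w w' m : target n (w ++ w') = Some m ->
  exists2 k, target n w = Some k & target k w' = Some m.
Proof. by rewrite target_cat; case: (target n w) => //= k; exists k. Qed.

Lemma target_catE n w w' k : target n w = Some k -> target n (w ++ w') = target k w'.
Proof. by rewrite target_cat => ->. Qed.

Lemma linear_comp (U V W : lmodType Lambda) (g : V -> W) (f : U -> V) :
  linear g -> linear f -> linear (fun x => g (f x)).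
Proof. by move=> gl fl c x y; rewrite fl gl. Qed.

Lemma linear_id (U : lmodType Lambda) : linear (fun x : U => x).
Proof. by []. Qed.

Lemma stackA n k l m (x : skein n k) (y : skein k l) (z : skein l m) :
  stack x (stack y z) = stack (stack x y) z.
Proof.
refine (@linear_eq n k _ (fun x => stack x (stack y z)) (fun x => stack (stack x y) z) _ _ _ x).
- exact: stack_linearl.
- exact: (linear_comp (stack_linearl z) (stack_linearl y)).
move=> w1 nw1; refine (@linear_eq k l _ (fun y => stack (cls n k w1) (stack y z))
  (fun y => stack (stack (cls n k w1) y) z) _ _ _ y).
- exact: (linear_comp (stack_linearr _) (stack_linearl z)).
- exact: (linear_comp (stack_linearl z) (stack_linearr (cls n k w1))).
move=> w2 nw2; refine (@linear_eq l m _ (fun z => stack (cls n k w1) (stack (cls k l w2) z))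
  (fun z => stack (stack (cls n k w1) (cls k l w2)) z) _ _ _ z).
- exact: (linear_comp (stack_linearr _) (stack_linearr _)).
- exact: stack_linearr.
move=> w3 nw3.
rewrite (stack_cls nw2 nw3) (stack_cls nw1 nw2).
by rewrite !stack_cls ?(target_catE _ nw1) ?(target_catE _ nw2) // catA.
Qed.

Lemma TL_oneE n : TL_one n = cls n n [::].
Proof. by rewrite /TL_one -clsE. Qed.

Lemma stack1l n m (x : skein n m) : stack (TL_one n) x = x.
Proof.
refine (@linear_eq n m _ (fun x => stack (TL_one n) x) (fun x => x) _ _ _ x).
- exact: stack_linearr.
- exact: linear_id.
by move=> w nw; rewrite TL_oneE stack_cls.
Qed.

Lemma stack1r n m (x : skein n m) : stack x (TL_one m) = x.
Proof.
refine (@linear_eq n m _ (fun x => stack x (TL_one m)) (fun x => x) _ _ _ x).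
- exact: stack_linearl.
- exact: linear_id.
by move=> w nw; rewrite TL_oneE stack_cls // cats0.
Qed.

(** Both words have to be assumed to fit: the empty side of a zigzag fits over any number of
    strands, the zigzag itself does not. *)
Lemma isotopy_target s t n k l : isotopy s t ->
  target n s = Some k -> target n t = Some l -> k = l.
Proof.
case=> [p q i j ij|i|i|b i|b i] /=; rewrite /= ?addn0 ?addn2 ?subn2 ?subn0;
  try (case: p => [||pb]; case: q => [||qb] /=);
  repeat (case: ifP => [?|//]); move=> [<-] [<-]; lia.
Qed.

Section Lift.
Variables (n m : nat) (V : lmodType Lambda) (f : seq layer -> V).
Hypothesis f_isotopy : forall w s t w', isotopy s t ->
  target n (w ++ s ++ w') = Some m -> target n (w ++ t ++ w') = Some m ->
  f (w ++ s ++ w') = f (w ++ t ++ w').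
Hypothesis f_loop : forall w i w',
  target n (w ++ [:: (Cup, i); (Cap, i)] ++ w') = Some m ->
  f (w ++ [:: (Cup, i); (Cap, i)] ++ w') = delta *: f (w ++ w').
Hypothesis f_bracket : forall w b i w',
  target n (w ++ [:: (Cross b, i)] ++ w') = Some m ->
  f (w ++ [:: (Cross b, i)] ++ w') = (if b then A else A^-1) *: f (w ++ w') +
    (if b then A^-1 else A) *: f (w ++ [:: (Cap, i); (Cup, i)] ++ w').

(** The universal property of the skein module. A representative is chosen without any proof;
    invariance under the three relations enters in [lift_linear] and [lift_cls]. *)
Definition lift (x : skein n m) : V :=
  lin_ext (fun t : tangle n m => f t) (repr x).

Let F := lin_ext (fun t : tangle n m => f t).
Let Fl : linear F := lin_ext_is_linear _.

Let F_null x : skein_null x -> F x = 0.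
Proof.
elim=> {x} [|x y _ Fx _ Fy|c x _ Fx|k l u s t v st|k u o v i Eo|k u x e v b i Ex Ee].
- exact: lin0.
- by rewrite linD // Fx Fy addr0.
- by rewrite linZ // Fx scaler0.
- rewrite (linB Fl) /F !lin_extU; apply/eqP; rewrite subr_eq0; apply/eqP => /=.
  rewrite -!catA; apply: f_isotopy => //.
    by rewrite !(target_catE _ (tangle_target _)) tangle_target.
  by rewrite !(target_catE _ (tangle_target _)) tangle_target.
- rewrite (linB Fl) (linZ Fl delta) /F !lin_extU /= -catA Eo f_loop ?subrr //.
  by rewrite -Eo !(target_catE _ (tangle_target _)) tangle_target.
rewrite (lin_bracket _ _ _ _ _ Fl) /F !lin_extU /= -!catA Ex Ee f_bracket.
  by rewrite -addrA -opprD subrr.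
by rewrite -Ex !(target_catE _ (tangle_target _)) tangle_target.
Qed.

Let lift_pi (x : formal n m) : lift (\pi_(skein n m) x) = F x.
Proof.
apply/eqP; rewrite -subr_eq0 -(linB Fl); apply/eqP/F_null/asboolP.
by apply/skein_eqP; rewrite reprK.
Qed.

Lemma lift_linear : linear lift.
Proof.
move=> c; elim/quotW=> x; elim/quotW=> y.
by rewrite -pi_skeinP !lift_pi Fl.
Qed.

Lemma lift_cls w : target n w = Some m -> lift (cls n m w) = f w.
Proof.
by move=> /target_tangle[t <-]; rewrite clsE lift_pi /F lin_extU.
Qed.

End Lift.

Lemma cls_isotopy n m w s t w' : isotopy s t ->
  target n (w ++ s ++ w') = Some m -> target n (w ++ t ++ w') = Some m ->
  cls n m (w ++ s ++ w') = cls n m (w ++ t ++ w').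
Proof.
move=> st /target_catP[k /target_tangle[u <-]].
move=> /target_catP[l ks /target_tangle[v <-]].
rewrite (target_catE _ (tangle_target u)) => /target_catP[l' kt _].
have El := isotopy_target st ks kt; rewrite -{l'}El in kt.
case/target_tangle: ks => s' Es; case/target_tangle: kt => t' Et.
rewrite -Es -Et !cls_cat3.
apply/skein_eqP/asboolP; apply: skein_null_isotopy; by rewrite Es Et.
Qed.

Lemma cls_loop n m w i w' :
  target n (w ++ [:: (Cup, i); (Cap, i)] ++ w') = Some m ->
  cls n m (w ++ [:: (Cup, i); (Cap, i)] ++ w') = delta *: cls n m (w ++ w').
Proof.
move=> /target_catP[k /target_tangle[u <-]] /target_catP[l ko].
have El : k = l by move: ko => /=; do 2 (case: ifP => [?|//]); case=> <-; lia.
rewrite -{l}El in ko *; case/target_tangle: ko => o Eo /target_tangle[v <-].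
rewrite -Eo cls_cat3 cls_cat /skein_class -pi_skeinZ; apply/skein_eqP/asboolP.
exact: skein_null_loop Eo.
Qed.

Lemma cls_bracket n m w b i w' :
  target n (w ++ [:: (Cross b, i)] ++ w') = Some m ->
  cls n m (w ++ [:: (Cross b, i)] ++ w') =
    (if b then A else A^-1) *: cls n m (w ++ w') +
    (if b then A^-1 else A) *: cls n m (w ++ [:: (Cap, i); (Cup, i)] ++ w').
Proof.
move=> /target_catP[k /target_tangle[u <-]] /target_catP[l kx].
have [El ke] : k = l /\ target k [:: (Cap, i); (Cup, i)] = Some k.
  move: kx => /=; case: ifP => [ik|//]; case=> <-.
  by rewrite addn0; case: ifP => ?; [split; [|congr Some]; lia | lia].
rewrite -{l}El in kx *.
case/target_tangle: kx => x Ex; case/target_tangle: ke => e Ee /target_tangle[v <-].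
rewrite -Ex -Ee !cls_cat3 cls_cat /skein_class.
have := skein_null_bracket u v Ex Ee.
move: << _ >> << _ >> << _ >> => r q p null_pqr.
rewrite -(pi_skeinZ _ r) -pi_skeinP; apply/skein_eqP/asboolP.
by rewrite opprD addrA.
Qed.

Lemma subword_bracket n m w b i w' :
  target n (w ++ [:: (Cross b, i)] ++ w') = Some m -> target n (w ++ w') = Some m /\
  target n (w ++ [:: (Cap, i); (Cup, i)] ++ w') = Some m.
Proof.
move=> /target_catP[k nk] /target_catP[l ko lw]; rewrite !(target_catE _ nk) /=.
move: ko => /=; case: ifP => [ik|//]; case=> El; rewrite -lw -El.
split; first by congr target; lia.
by case: ifP => ?; [congr target|]; lia.
Qed.

(** * Adding a strand and reflecting *)

Lemma target_wid n m w : target n w = Some m -> target n.+1 w = Some m.+1.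
Proof.
elim: w n => [n [->]//|[p i] w IHw] n /=.
case: ifP => [ip|//]; case: ifP => [_ /IHw <-|]; last by lia.
by congr target; case: p ip => [||b] /=; lia.
Qed.

(** A layer records only the strands to its left, so a strand added on the right shows in the
    arities alone. *)
Definition wid n m (x : skein n m) : skein n.+1 m.+1 := lift (cls n.+1 m.+1) x.

Lemma wid_linear n m : linear (@wid n m).
Proof.
apply: lift_linear => [w s t w' st ns nt|w i w' nw|w b i w' nw].
- by apply: cls_isotopy; rewrite // ?(target_wid ns) ?(target_wid nt).
- by apply: cls_loop; rewrite (target_wid nw).
by apply: cls_bracket; rewrite (target_wid nw).
Qed.

Lemma wid_cls n m w : target n w = Some m -> wid (cls n m w) = cls n.+1 m.+1 w.
Proof.
apply: lift_cls => [u s t w' st ns nt|u i w' nw|u b i w' nw].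
- by apply: cls_isotopy; rewrite // ?(target_wid ns) ?(target_wid nt).
- by apply: cls_loop; rewrite (target_wid nw).
by apply: cls_bracket; rewrite (target_wid nw).
Qed.

Lemma wid_stack n k m (x : skein n k) (y : skein k m) :
  wid (stack x y) = stack (wid x) (wid y).
Proof.
refine (@linear_eq n k _ (fun x => wid (stack x y)) (fun x => stack (wid x) (wid y))
  _ _ _ x).
- exact: (linear_comp (@wid_linear _ _) (stack_linearl y)).
- exact: (linear_comp (stack_linearl (wid y)) (@wid_linear _ _)).
move=> w1 nw1; refine (@linear_eq k m _ (fun y => wid (stack (cls n k w1) y))
  (fun y => stack (wid (cls n k w1)) (wid y)) _ _ _ y).
- exact: (linear_comp (@wid_linear _ _) (stack_linearr (cls n k w1))).
- exact: (linear_comp (stack_linearr (wid (cls n k w1))) (@wid_linear _ _)).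
move=> w2 nw2; rewrite (stack_cls nw1 nw2) !wid_cls ?(target_catE _ nw1) //.
by rewrite stack_cls // ?(target_wid nw1) // (target_wid nw2).
Qed.

Lemma wid_one n : wid (TL_one n) = TL_one n.+1.
Proof. by rewrite !TL_oneE wid_cls. Qed.

(* Unlike [reflect_piece], which makes a mirror image, this keeps the sign of a
   crossing, so that the reflection is linear rather than semilinear with
   respect to [A -> A^-1]; the two agree on crossing-free words. *)
Definition flip (p : piece) : piece :=
  match p with Cup => Cap | Cap => Cup | Cross b => Cross b end.

Definition flip_word (w : seq layer) : seq layer :=
  rev [seq (flip x.1, x.2) | x <- w].

Lemma flip_word_cat w w' : flip_word (w ++ w') = flip_word w' ++ flip_word w.
Proof. by rewrite /flip_word map_cat rev_cat. Qed.

Lemma flip_word_reflect w : crossing_free w -> flip_word w = reflect_word w.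
Proof.
rewrite /crossing_free /flip_word /reflect_word => /allP cfw; congr rev.
by apply/eq_in_map => -[[||b] i] /cfw.
Qed.

Lemma target_flip n m w : target n w = Some m -> target m (flip_word w) = Some n.
Proof.
elim: w n => [n [->]//|[p i] w IHw] n /=; case: ifP => [ip /IHw nw|//].
rewrite -cat1s flip_word_cat (target_catE _ nw) /=.
by case: p ip {IHw nw} => [||b] /= ip; (case: ifP => ?; [congr Some|]); lia.
Qed.

(** Reflection swaps the two zigzags and swaps the moves at a minimum and at a maximum; an exchange
    of heights comes out reversed, hence the disjunction. *)
Lemma isotopy_flip s t :
  isotopy s t -> isotopy (flip_word s) (flip_word t) \/ isotopy (flip_word t) (flip_word s).
Proof.
case=> [p q i j ij|i|i|b i|b i]; rewrite /flip_word /rev /=.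
- have := isotopy_exchange (flip p) (flip q) ij.
  have -> : outputs (flip p) = inputs p by case: p.
  have -> : inputs (flip p) = outputs p by case: p.
  by right.
- by left; apply: isotopy_zigzagr.
- by left; apply: isotopy_zigzagl.
- by left; apply: isotopy_max.
by left; apply: isotopy_min.
Qed.

Definition refl n m (x : skein n m) : skein m n :=
  lift (fun w => cls m n (flip_word w)) x.

Lemma refl_isotopy n m w s t w' : isotopy s t ->
  target n (w ++ s ++ w') = Some m -> target n (w ++ t ++ w') = Some m ->
  cls m n (flip_word (w ++ s ++ w')) = cls m n (flip_word (w ++ t ++ w')).
Proof.
move=> /isotopy_flip st /target_flip ns /target_flip nt.
rewrite !flip_word_cat -!catA in ns nt *.
by case: st => st; [|symmetry]; apply: cls_isotopy.
Qed.

Lemma refl_loop n m w i w' :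
  target n (w ++ [:: (Cup, i); (Cap, i)] ++ w') = Some m ->
  cls m n (flip_word (w ++ [:: (Cup, i); (Cap, i)] ++ w')) =
    delta *: cls m n (flip_word (w ++ w')).
Proof.
move=> /target_flip nw; rewrite !flip_word_cat -!catA in nw *.
exact: cls_loop.
Qed.

Lemma refl_bracket n m w b i w' :
  target n (w ++ [:: (Cross b, i)] ++ w') = Some m ->
  cls m n (flip_word (w ++ [:: (Cross b, i)] ++ w')) =
    (if b then A else A^-1) *: cls m n (flip_word (w ++ w')) +
    (if b then A^-1 else A) *:
      cls m n (flip_word (w ++ [:: (Cap, i); (Cup, i)] ++ w')).
Proof.
move=> /target_flip nw; rewrite !flip_word_cat -!catA in nw *.
exact: cls_bracket.
Qed.

Lemma refl_linear n m : linear (@refl n m).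
Proof.
by apply: lift_linear; [exact: refl_isotopy|exact: refl_loop|exact: refl_bracket].
Qed.

Lemma refl_cls n m w : target n w = Some m -> refl (cls n m w) = cls m n (flip_word w).
Proof.
apply: (lift_cls (f := fun w => cls m n (flip_word w))).
- exact: refl_isotopy.
- exact: refl_loop.
exact: refl_bracket.
Qed.

Lemma refl_stack n k m (x : skein n k) (y : skein k m) :
  refl (stack x y) = stack (refl y) (refl x).
Proof.
refine (@linear_eq n k _ (fun x => refl (stack x y)) (fun x => stack (refl y) (refl x))
  _ _ _ x).
- exact: (linear_comp (@refl_linear _ _) (stack_linearl y)).
- exact: (linear_comp (stack_linearr (refl y)) (@refl_linear _ _)).
move=> w1 nw1; refine (@linear_eq k m _ (fun y => refl (stack (cls n k w1) y))
  (fun y => stack (refl y) (refl (cls n k w1))) _ _ _ y).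
- exact: (linear_comp (@refl_linear _ _) (stack_linearr (cls n k w1))).
- exact: (linear_comp (stack_linearl (refl (cls n k w1))) (@refl_linear _ _)).
move=> w2 nw2; rewrite (stack_cls nw1 nw2) !refl_cls ?(target_catE _ nw1) //.
by rewrite stack_cls ?(target_flip nw1) ?(target_flip nw2) // flip_word_cat.
Qed.

Lemma refl_one n : refl (TL_one n) = TL_one n.
Proof. by rewrite !TL_oneE refl_cls. Qed.

Lemma refl_wid n m (x : skein n m) : refl (wid x) = wid (refl x).
Proof.
refine (@linear_eq n m _ (fun x => refl (wid x)) (fun x => wid (refl x)) _ _ _ x).
- exact: (linear_comp (@refl_linear _ _) (@wid_linear _ _)).
- exact: (linear_comp (@wid_linear _ _) (@refl_linear _ _)).
move=> w nw; rewrite wid_cls // !refl_cls ?(target_wid nw) // wid_cls //.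
exact: target_flip.
Qed.

Lemma reflK n m (x : skein n m) : refl (refl x) = x.
Proof.
refine (@linear_eq n m _ (fun x => refl (refl x)) (fun x => x) _ _ _ x).
- by apply: linear_comp; apply: refl_linear.
- exact: linear_id.
move=> w nw; rewrite refl_cls // refl_cls ?(target_flip nw) //.
rewrite /flip_word map_rev revK -map_comp map_id_in // => -[[||b] i] //.
Qed.

Definition cap n : skein n.+2 n := cls n.+2 n [:: (Cap, n)].
Definition cup n : skein n n.+2 := cls n n.+2 [:: (Cup, n)].

Lemma target_cap n : target n.+2 [:: (Cap, n)] = Some n.
Proof. by rewrite /= addn2 leqnn subn2 addn0. Qed.

Lemma target_cup n : target n [:: (Cup, n)] = Some n.+2.
Proof. by rewrite /= addn0 leqnn subn0 addn2. Qed.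

Lemma refl_cap n : refl (cap n) = cup n.
Proof. by rewrite refl_cls // target_cap. Qed.

Lemma refl_cup n : refl (cup n) = cap n.
Proof. by rewrite refl_cls // target_cup. Qed.

Lemma cup_cap n : stack (cup n) (cap n) = delta *: TL_one n.
Proof.
rewrite stack_cls ?target_cap ?target_cup // TL_oneE.
apply: (@cls_loop n n [::] n [::]).
by rewrite cats0 -cat1s (target_catE _ (target_cup n)) target_cap.
Qed.

Lemma wid_cup_cap n : stack (wid (cup n)) (cap n.+1) = TL_one n.+1.
Proof.
have tc := target_wid (target_cup n).
rewrite wid_cls ?target_cup // stack_cls ?target_cap // TL_oneE.
apply: (@cls_isotopy n.+1 n.+1 [::] _ [::] [::] (isotopy_zigzagl n)) => //.
by rewrite cats0 -cat1s (target_catE _ tc) target_cap.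
Qed.

Lemma cup_wid_cap n : stack (cup n.+1) (wid (cap n)) = TL_one n.+1.
Proof.
have tc := target_wid (target_cap n).
rewrite wid_cls ?target_cap // stack_cls ?target_cup // TL_oneE.
apply: (@cls_isotopy n.+1 n.+1 [::] _ [::] [::] (isotopy_zigzagr n)) => //.
by rewrite cats0 -cat1s (target_catE _ (target_cup n.+1)) tc.
Qed.

(** The maximum lies to the right of all of [w] and climbs by one exchange of heights per layer, its
    position following the number of strands. *)
Lemma cap_slide n m w : target n w = Some m ->
  cls n.+2 m ((Cap, n) :: w) = cls n.+2 m (w ++ [:: (Cap, m)]).
Proof.
elim: w n => [n [->]//|[p i] w IHw] n /=; case: ifP => // ip nw.
set n' := (n - inputs p + outputs p)%N in nw.
have np : target n.+2 [:: (p, i)] = Some n'.+2.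
  by apply/target_wid/target_wid; rewrite /= ip.
have nCw : target n'.+2 ((Cap, n') :: w) = Some m.
  by rewrite -cat1s (target_catE _ (target_cap n')).
have nwC : target n'.+2 (w ++ [:: (Cap, m)]) = Some m.
  by rewrite (target_catE _ (target_wid (target_wid nw))) target_cap.
rewrite -[in RHS]cat1s -(stack_cls np nwC) -IHw // (stack_cls np nCw).
have Ei : [:: (Cap, n), (p, i) & w] =
    [::] ++ [:: (Cap, (n - inputs p) + inputs p)%N; (p, i)] ++ w by rewrite subnK //; lia.
have Eo : [:: (p, i)] ++ (Cap, n') :: w =
    [::] ++ [:: (p, i); (Cap, (n - inputs p) + outputs p)%N] ++ w by [].
have tEo := target_catE ((Cap, n') :: w) np; rewrite nCw Eo in tEo.
rewrite Eo Ei; symmetry; apply: cls_isotopy => //.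
  by apply: isotopy_exchange; lia.
by rewrite -Ei -cat1s (target_catE _ (target_cap n)) /= ip.
Qed.

Lemma cap_natural n m (x : skein n m) :
  stack (cap n) x = stack (wid (wid x)) (cap m).
Proof.
refine (@linear_eq n m _ (fun x => stack (cap n) x)
  (fun x => stack (wid (wid x)) (cap m)) _ _ _ x).
- exact: stack_linearr.
- apply: (linear_comp (stack_linearl (cap m)) (linear_comp _ _)); exact: wid_linear.
move=> w nw; have nw2 := target_wid (target_wid nw).
rewrite wid_cls // wid_cls ?(target_wid nw) //.
rewrite (stack_cls (target_cap n) nw) (stack_cls nw2 (target_cap m)).
exact: cap_slide.
Qed.

Lemma cup_natural n m (x : skein n m) :
  stack x (cup m) = stack (cup n) (wid (wid x)).
Proof.
by rewrite -[LHS]reflK refl_stack refl_cup cap_natural refl_stack !refl_wid reflK refl_cap.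
Qed.

Lemma crossing_split w : crossing_free w \/
  exists w1 b i w2, w = w1 ++ [:: (Cross b, i)] ++ w2.
Proof.
elim: w => [|[p i] w IHw]; first by left.
case: p => [||b]; last by right; exists [::], b, i, w.
  by case: IHw => [|[w1 [b [j [w2 ->]]]]]; [left|right; exists ((Cup, i) :: w1), b, j, w2].
by case: IHw => [|[w1 [b [j [w2 ->]]]]]; [left|right; exists ((Cap, i) :: w1), b, j, w2].
Qed.

(** Induction on the number of crossings: both smoothings in the bracket relation have one fewer. *)
Lemma crossing_free_ind n m (P : skein n m -> Prop) :
  P 0 -> (forall x y, P x -> P y -> P (x + y)) ->
  (forall c x, P x -> P (c *: x)) ->
  (forall w, crossing_free w -> target n w = Some m -> P (cls n m w)) -> forall x, P x.
Proof.
move=> P0 PD PZ Pw; apply: skein_word_ind => // w.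
have [N] := ubnP (count (fun x => if x.1 is Cross _ then true else false) w).
elim: N w => // N IHN w; case: (crossing_split w) => [cfw _|]; first exact: Pw.
case=> w1 [b [i [w2 ->]]]; rewrite !count_cat /= => lt_w nw.
have [nw' nw''] := subword_bracket nw; rewrite cls_bracket //.
by apply: PD; apply/PZ/IHN; rewrite // !count_cat /=; lia.
Qed.

(** * The state sum *)

Definition del i (s : nat -> bool) : nat -> bool :=
  fun k => if (k < i)%N then s k else s k.+2.
Definition ins i (a b : bool) (s : nat -> bool) : nat -> bool :=
  fun k => if (k < i)%N then s k else if k == i then a else if k == i.+1 then b
           else s k.-2.

(* Kauffman's state model: strands are labelled by booleans, a local minimum
   has weight [cup_weight], a local maximum the entries of the inverse matrix;
   loops then evaluate to [- A ^+ 2 - A ^- 2].  Labels are functions on [nat],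
   as if infinitely many vertical strands were added on the right. *)
Definition cup_weight (a b : bool) : Lambda :=
  match a, b with
  | false, true => A
  | true, false => - A^-1
  | _, _ => 0
  end.

Definition state := (nat -> bool) -> Lambda.

Definition cup_op i (f : state) : state :=
  fun s => cup_weight (s i) (s i.+1) * f (del i s).
Definition cap_op i (f : state) : state :=
  fun s => A^-1 * f (ins i true false s) - A * f (ins i false true s).
Definition op (f : state) (x : layer) : state :=
  match x.1 with
  | Cup => cup_op x.2 f
  | Cap => cap_op x.2 f
  | Cross b => fun s => (if b then A else A^-1) * f s
      + (if b then A^-1 else A) * cup_op x.2 (cap_op x.2 f) s
  end.

Lemma A_unit : A \is a GRing.unit.
Proof.
rewrite [_ \is a _]unfold_in /= /Lambda_unit /=.
apply/andP; split; first by rewrite tofrac_eq0 polyX_eq0.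
apply/asboolP; exists 1, 1%N, [::].
by rewrite /Lambda_den big_nil mulr1 expr1 rmorph1 div1r.
Qed.

Lemma ins_lt i a b s k : (k < i)%N -> ins i a b s k = s k.
Proof. by rewrite /ins => ->. Qed.

Lemma del_ins i a b s : del i (ins i a b s) = s.
Proof.
apply/funext => k; rewrite /del /ins; case: ifP => ki; first by rewrite ki.
have -> : (k.+2 < i)%N = false by lia.
have -> : (k.+2 == i) = false by apply/eqP; lia.
by have -> : (k.+2 == i.+1) = false by apply/eqP; lia.
Qed.

Lemma ins_ii i a b s : ins i a b s i = a.
Proof. by rewrite /ins ltnn eqxx. Qed.

Lemma ins_iS i a b s : ins i a b s i.+1 = b.
Proof. by rewrite /ins ltnNge leqnSn gtn_eqF //= eqxx. Qed.

Lemma ins_ge i a b s k : (i.+2 <= k)%N -> ins i a b s k = s k.-2.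
Proof.
move=> ik; rewrite /ins; have -> : (k < i)%N = false by lia.
have -> : (k == i) = false by apply/eqP; lia.
by have -> : (k == i.+1) = false by apply/eqP; lia.
Qed.

Ltac label_ext :=
  apply/funext => ?; rewrite /del /ins;
  repeat (case: ifP => ?); try (exfalso; lia); try done; try (congr (_ _); lia).

Lemma del_del i j s : (i <= j)%N -> del j (del i s) = del i (del j.+2 s).
Proof. by move=> ij; label_ext. Qed.

Lemma ins_ins i j a b c d s : (i <= j)%N ->
  ins i a b (ins j c d s) = ins j.+2 c d (ins i a b s).
Proof. by move=> ij; label_ext. Qed.

Lemma ins_del_lt i j a b s : (i <= j)%N ->
  ins i a b (del j s) = del j.+2 (ins i a b s).
Proof. by move=> ij; label_ext. Qed.

Lemma ins_del_gt i j a b s : (i <= j)%N ->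
  ins j a b (del i s) = del i (ins j.+2 a b s).
Proof. by move=> ij; label_ext. Qed.

Lemma del_insS i b c s : del i (ins i.+1 b c s) = fun k => if k == i then c else s k.
Proof. by label_ext. Qed.

Lemma del_Sins i b c s : del i.+1 (ins i b c s) = fun k => if k == i then b else s k.
Proof. by label_ext. Qed.

Lemma relabel_id i (s : nat -> bool) : (fun k => if k == i then s i else s k) = s.
Proof. by apply/funext => k; case: eqP => [->|]. Qed.

Lemma del_lt i s k : (k < i)%N -> del i s k = s k.
Proof. by rewrite /del => ->. Qed.

Lemma del_ge i s k : (i <= k)%N -> del i s k = s k.+2.
Proof. by rewrite /del ltnNge => ->. Qed.

Lemma op_loop i f : op (op f (Cup, i)) (Cap, i) = fun s => delta * f s.
Proof.
apply/funext => s; rewrite /op /= /cap_op /cup_op !ins_ii !ins_iS !del_ins /=.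
by rewrite /delta -exprVn; move: A^-1 => B; ring.
Qed.

(** Of the two labellings inserted by the maximum, the weight of the minimum keeps the one whose
    surviving label is [s i]; the two weights multiply to 1. *)
Lemma op_zigzagl i f : op (op f (Cup, i)) (Cap, i.+1) = f.
Proof.
apply/funext => s; rewrite /op /= /cap_op /cup_op !(fun a b => @ins_lt i.+1 a b s i (ltnSn i)).
rewrite !ins_ii !del_insS.
case Es: (s i) => /=; rewrite -Es relabel_id mul0r mulr0 ?sub0r ?subr0 mulrA.
  by rewrite mulrN mulrV ?A_unit // mulN1r opprK.
by rewrite mulVr ?A_unit // mul1r.
Qed.

Lemma op_zigzagr i f : op (op f (Cup, i.+1)) (Cap, i) = f.
Proof.
apply/funext => s; rewrite /op /= /cap_op /cup_op !ins_iS !ins_ge // !del_Sins /=.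
case Es: (s i) => /=; rewrite -Es relabel_id mul0r mulr0 ?sub0r ?subr0 mulrA.
  by rewrite mulVr ?A_unit // mul1r.
by rewrite mulrN mulrV ?A_unit // mulN1r opprK.
Qed.

Lemma op_linear f g c d x :
  op (fun s => c * f s + d * g s) x = fun s => c * op f x s + d * op g x s.
Proof.
apply/funext => s; case: x => [[||b] i]; rewrite /op /= /cup_op /cap_op.
- by move: (cup_weight _ _) => w; ring.
- by move: A A^-1 => a B; ring.
by case: b; move: (cup_weight _ _) A A^-1 => w a B; ring.
Qed.

Definition noncrossing (p : piece) := if p is Cross _ then false else true.

Lemma op_exchange_noncrossing p q i j f : (i <= j)%N ->
  noncrossing p -> noncrossing q ->
  op (op f (p, i)) (q, j + outputs p)%N = op (op f (q, j + inputs p)%N) (p, i).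
Proof.
move=> ij; have lt1 : (i < j.+2)%N by lia.
have lt2 : (i.+1 < j.+2)%N by lia.
have le3 : (i <= j.+1)%N by lia.
have le4 : (i.+2 <= j.+2)%N by lia.
have le5 : (i.+2 <= j.+3)%N by lia.
case: p => [||//]; case: q => [||//] _ _; apply/funext => s;
  rewrite /op /= ?addn0 ?addn2 /cup_op /cap_op.
- rewrite (del_lt s lt1) (del_lt s lt2) (del_del _ ij) (del_ge s ij) (del_ge s le3).
  exact: mulrCA.
- rewrite !(ins_del_gt _ _ s ij) !(ins_lt _ _ s lt1) !(ins_lt _ _ s lt2).
  by move: (cup_weight _ _) A A^-1 => w a B; ring.
- rewrite !(ins_del_lt _ _ s ij) !(ins_ge _ _ s le4) !(ins_ge _ _ s le5) /=.
  by move: (cup_weight _ _) A A^-1 => w a B; ring.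
rewrite !(ins_ins _ _ _ _ s ij).
by move: A A^-1 => a B; ring.
Qed.

Lemma op_cross f b i : op f (Cross b, i) =
  fun s => (if b then A else A^-1) * f s
           + (if b then A^-1 else A) * op (op f (Cap, i)) (Cup, i) s.
Proof. by []. Qed.

(** By [op_cross] a crossing is a combination of the identity and a hook, so linearity reduces to
    the noncrossing cases. *)
Lemma op_exchange p q i j f : (i <= j)%N ->
  op (op f (p, i)) (q, j + outputs p)%N = op (op f (q, j + inputs p)%N) (p, i).
Proof.
move=> ij.
wlog: p f / noncrossing p => [IH|ncp].
  case: p => [||b]; try exact: IH.
  rewrite !op_cross op_linear; apply/funext => s /=; congr (_ + _ * _).
  have := IH Cup (op f (Cap, i)) isT; rewrite /= addn0 => ->.
  by have := IH Cap f isT; rewrite /= addn0 => ->.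
case: q => [||b].
- exact: (op_exchange_noncrossing (q := Cup) f ij ncp isT).
- exact: (op_exchange_noncrossing (q := Cap) f ij ncp isT).
rewrite !op_cross op_linear; apply/funext => s /=; congr (_ + _ * _).
have E g := op_exchange_noncrossing (q := Cap) g ij ncp isT.
by rewrite E (op_exchange_noncrossing (q := Cup) _ ij ncp isT).
Qed.

(** For a crossing turned around an extremum, one smoothing on each side straightens by a zigzag.
    The two smoothings trade places between the sides, and so do the coefficients when [b] is
    negated. *)
Lemma op_isotopy s t f : isotopy s t -> foldl op f s = foldl op f t.
Proof.
case=> [p q i j ij|i|i|b i|b i].
- exact: op_exchange.
- exact: op_zigzagl.
- exact: op_zigzagr.
- rewrite [LHS]op_cross op_zigzagl [RHS]op_cross op_zigzagr.
  by apply/funext => u; case: b; rewrite addrC.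
rewrite [LHS]/= [RHS]/= !op_cross !op_linear op_zigzagl op_zigzagr.
by apply/funext => u; case: b; rewrite addrC.
Qed.

(** For a word from 0 to 0 only the fictitious strands carry labels at the end; all are set to
    [false]. *)
Definition state_sum (w : seq layer) : Lambda :=
  foldl op (fun _ => 1) w (fun _ => false).

Lemma foldl_op_linear f g c d w :
  foldl op (fun s => c * f s + d * g s) w =
  fun s => c * foldl op f w s + d * foldl op g w s.
Proof. by elim: w f g => //= x w IHw f g; rewrite op_linear IHw. Qed.

Lemma foldl_op_scale f c w :
  foldl op (fun s => c * f s) w = fun s => c * foldl op f w s.
Proof.
have -> : (fun s => c * f s) = (fun s => c * f s + 0 * f s).
  by apply/funext => s; rewrite mul0r addr0.
by rewrite foldl_op_linear; apply/funext => s; rewrite mul0r addr0.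
Qed.

Definition bracket (x : skein 0 0) : Lambda := lift (state_sum : _ -> Lambda^o) x.

Lemma state_sum_isotopy w s t w' : isotopy s t ->
  state_sum (w ++ s ++ w') = state_sum (w ++ t ++ w').
Proof. by move=> st; rewrite /state_sum !foldl_cat (op_isotopy _ st). Qed.

Lemma state_sum_loop w i w' :
  state_sum (w ++ [:: (Cup, i); (Cap, i)] ++ w') = delta * state_sum (w ++ w').
Proof.
by rewrite /state_sum !foldl_cat [foldl _ _ [:: _; _]]op_loop foldl_op_scale.
Qed.

Lemma state_sum_bracket w b i w' :
  state_sum (w ++ [:: (Cross b, i)] ++ w') =
    (if b then A else A^-1) * state_sum (w ++ w') +
    (if b then A^-1 else A) * state_sum (w ++ [:: (Cap, i); (Cup, i)] ++ w').
Proof.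
by rewrite /state_sum !foldl_cat [foldl _ _ [:: _]]op_cross foldl_op_linear.
Qed.

Lemma bracket_linear : linear (bracket : _ -> Lambda^o).
Proof.
apply: lift_linear => [w s t w' st _ _|w i w' _|w b i w' _].
- exact: state_sum_isotopy.
- exact: state_sum_loop.
exact: state_sum_bracket.
Qed.

Lemma bracket_cls w : target 0 w = Some 0 -> bracket (cls 0 0 w) = state_sum w.
Proof.
apply: (lift_cls (V := Lambda^o)) => [u s t u' st _ _|u i u' _|u b i u' _].
- exact: state_sum_isotopy.
- exact: state_sum_loop.
exact: state_sum_bracket.
Qed.

Lemma bracket_one : bracket (TL_one 0) = 1.
Proof. by rewrite TL_oneE bracket_cls. Qed.

(** * Normal form of crossing-free words *)

Definition is_cap (x : layer) := if x.1 is Cap then true else false.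
Definition is_cup (x : layer) := if x.1 is Cup then true else false.

Lemma caps_crossing_free w : all is_cap w -> crossing_free w.
Proof. by apply: sub_all => -[[]]. Qed.

Lemma cups_crossing_free w : all is_cup w -> crossing_free w.
Proof. by apply: sub_all => -[[]]. Qed.

Lemma crossing_free_cat w w' :
  crossing_free (w ++ w') = crossing_free w && crossing_free w'.
Proof. exact: all_cat. Qed.

Local Notation labels st := st.1.1.
Local Notation fresh st := st.1.2.
Local Notation loops st := st.2.
Definition wf_state (st : trace_state) := all (gtn (fresh st)) (labels st).

Definition relabel k (st st' : trace_state) :=
  [/\ exists2 f, {in labels st' &, injective f} & labels st = map f (labels st'),
      loops st = (loops st' + k)%N, wf_state st & wf_state st'].

Lemma relabel_refl st : wf_state st -> relabel 0 st st.
Proof. by move=> wst; split; rewrite ?addn0 //; exists id; rewrite ?map_id. Qed.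

Lemma relabel_trans k l st st' st'' :
  relabel k st st' -> relabel l st' st'' -> relabel (k + l) st st''.
Proof.
case=> [[f f_inj Ef] El wst _] [[g g_inj Eg] El' _ wst'']; split => //.
  exists (f \o g); last by rewrite Ef Eg map_comp.
  move=> x y sx sy /f_inj fg; apply: g_inj => //.
  by apply: fg; rewrite Eg map_f.
by rewrite El El' -addnA (addnC l).
Qed.

Arguments trace_step : simpl never.

Lemma trace_cup x y c l :
  trace_step (x ++ y, c, l) (Cup, size x) = (x ++ c :: c :: y, c.+1, l).
Proof. by rewrite /trace_step take_size_cat // drop_size_cat. Qed.

Lemma trace_cap x a b y c l :
  trace_step (x ++ a :: b :: y, c, l) (Cap, size x) =
  if a == b then (x ++ y, c, l.+1)
  else ([seq if z == b then a else z | z <- x ++ y], c, l).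
Proof.
rewrite /trace_step nth_cat ltnn subnn nth_cat ltnNge leqnSn subSnn /=.
rewrite take_size_cat //.
have -> : drop (size x).+2 (x ++ a :: b :: y) = y.
  by rewrite -(cat1s a) -(cat1s b) !catA drop_size_cat // !size_cat /= !addn1.
by [].
Qed.

Lemma split_at (T : Type) i (s : seq T) : (i <= size s)%N ->
  exists x y, s = x ++ y /\ size x = i.
Proof. by move=> is_; exists (take i s), (drop i s); rewrite cat_take_drop size_takel. Qed.

Lemma split_at2 (T : Type) i (s : seq T) : (i + 2 <= size s)%N ->
  exists x a b y, s = x ++ a :: b :: y /\ size x = i.
Proof.
move=> is_; have /split_at[x [y [Es Ex]]] : (i <= size s)%N by lia.
case: y => [|a [|b y]] in Es; try by move: is_; rewrite Es size_cat /= Ex; lia.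
by exists x, a, b, y.
Qed.

Lemma wf_notin st z : wf_state st -> (fresh st <= z)%N -> z \notin labels st.
Proof. by move=> /allP wst; apply: contraL => /wst /=; rewrite -ltnNge. Qed.

Lemma map_eq_in (f : nat -> nat) s : {in s, f =1 id} -> map f s = s.
Proof. by move=> /eq_in_map ->; rewrite map_id. Qed.

Lemma trace_step_wf st p i : noncrossing p ->
  (i + inputs p <= size (labels st))%N -> wf_state st ->
  wf_state (trace_step st (p, i)) /\
  size (labels (trace_step st (p, i))) = (size (labels st) - inputs p + outputs p)%N.
Proof.
case: st => [[s c] l]; rewrite /wf_state; case: p => [||b] // _.
  rewrite [(i + _)%N]addn0 => is_.
  have {is_}[x [y [-> <-]]] := split_at (is_ : (i <= size s)%N).
  rewrite trace_cup /=.
  rewrite !all_cat /= => /andP[xc yc]; rewrite ltnSn !size_cat /=; split; last by lia.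
  by apply/andP; split; [move: xc|move: yc]; apply: sub_all => z /=; lia.
move=> is_; have {is_}[x [a [b [y [-> <-]]]]] := split_at2 (is_ : (i + 2 <= size s)%N).
 rewrite trace_cap /= all_cat /= => /and4P[xc ac bc yc].
have sE : (size (x ++ y) = size (x ++ a :: b :: y) - 2 + 0)%N by rewrite !size_cat /=; lia.
case: eqP => _ /=; rewrite ?size_map sE; split => //; first by rewrite all_cat xc.
rewrite all_map all_cat; apply/andP; split; [move: xc|move: yc];
  by apply: sub_all => z /=; case: ifP.
Qed.

Lemma trace_step_relabel k st st' p i : noncrossing p ->
  (i + inputs p <= size (labels st'))%N ->
  relabel k st st' -> relabel k (trace_step st (p, i)) (trace_step st' (p, i)).
Proof.
move=> cfx xs [[f f_inj Ef] El wst wst'].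
have xs' : (i + inputs p <= size (labels st))%N by rewrite Ef size_map.
have [wx _] := trace_step_wf cfx xs' wst; have [wx' _] := trace_step_wf cfx xs wst'.
split=> // {xs'}.
  case: st st' wst wst' f_inj Ef xs {wx wx' El} => [[s c] l] [[s' c'] l'] wst wst' f_inj.
  rewrite /= => Es; subst s.
  case: p cfx => [||//] _.
    rewrite [(i + _)%N]addn0 => is_.
    have {is_}[x [y [Es <-]]] := split_at (is_ : (i <= size s')%N).
    subst s'.
    have := trace_cup (map f x) (map f y) c l; rewrite -map_cat size_map => ->.
    (* New label goes to new label: [c'] is not among the old labels, and [c] is not in their
       image. *)
    rewrite trace_cup /=; exists (fun z => if z == c' then c else f z); last first.
      rewrite !map_cat /= eqxx; congr (_ ++ _ :: _ :: _); apply/eq_in_map => z zs;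
        by rewrite ifN //; apply: contraTneq zs => ->; apply: contra (wf_notin wst' (leqnn c'));
        rewrite mem_cat => ->; rewrite ?orbT.
    set s' := x ++ y in f_inj wst wst' *.
    have s'E z : z \in x ++ [:: c', c' & y] -> (z == c') || (z \in s').
      by rewrite !mem_cat !inE => /or4P[]->; rewrite ?orbT.
    have fc z : z \in s' -> f z <> c.
      by move=> zs fz; have := wf_notin wst (leqnn c); rewrite /= -fz map_f.
    move=> z1 z2 /s'E/orP z1s /s'E/orP z2s.
    have [->|z1c] := eqVneq z1 c'; have [->|z2c] := eqVneq z2 c' => //.
    - by case: z2s => [/eqP z2E|/fc fz2 /esym//]; rewrite z2E eqxx in z2c.
    - by case: z1s => [/eqP z1E|/fc fz1 //]; rewrite z1E eqxx in z1c.
    case: z1s => [/eqP z1E|z1s]; first by rewrite z1E eqxx in z1c.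
    by case: z2s => [/eqP z2E|z2s]; [rewrite z2E eqxx in z2c|apply: f_inj].
  move=> is_; have {is_}[x [a [b [y [Es <-]]]]] := split_at2 (is_ : (i + 2 <= size s')%N).
  subst s'.
  have := trace_cap (map f x) (f a) (f b) (map f y) c l.
  rewrite map_cat /= size_map trace_cap => ->.
  have as' : a \in x ++ a :: b :: y by rewrite mem_cat !inE eqxx orbT.
  have bs' : b \in x ++ a :: b :: y by rewrite mem_cat !inE eqxx !orbT.
  have xys' z : z \in x ++ y -> z \in x ++ a :: b :: y.
    by rewrite !mem_cat !inE => /orP[]->; rewrite ?orbT.
  rewrite (inj_in_eq f_inj) //; case: eqP => ab /=.
    by exists f; [move=> z1 z2 /xys' ? /xys' ?; apply: f_inj|rewrite map_cat].
  (* The two merged classes take the name [a] on one side and [f a] on the other, so [f] still works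
     on the labels that remain. *)
  exists f.
    move=> _ _ /mapP[z1 /xys' z1s ->] /mapP[z2 /xys' z2s ->].
    by apply: f_inj; case: ifP.
  rewrite -map_cat -!map_comp; apply/eq_in_map => z /xys' zs /=.
  by rewrite (inj_in_eq f_inj) //; case: ifP.
case: st st' wst wst' f_inj Ef El xs {wx wx'} => [[s c] l] [[s' c'] l'] wst wst' f_inj.
rewrite /= => -> ->; case: p cfx => [||//] _ //.
move=> is_; have {is_}[x [a [b [y [Es <-]]]]] := split_at2 (is_ : (i + 2 <= size s')%N).
  subst s'.
have := trace_cap (map f x) (f a) (f b) (map f y) c (l' + k).
rewrite map_cat /= size_map trace_cap => ->.
have as' : a \in x ++ a :: b :: y by rewrite mem_cat !inE eqxx orbT.
have bs' : b \in x ++ a :: b :: y by rewrite mem_cat !inE eqxx !orbT.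
by rewrite (inj_in_eq f_inj) //; case: eqP.
Qed.

Lemma trace_wf n m w st : crossing_free w -> target n w = Some m ->
  size (labels st) = n -> wf_state st ->
  wf_state (foldl trace_step st w) /\ size (labels (foldl trace_step st w)) = m.
Proof.
elim: w n st => [n st _ [->]//|[p i] w IHw] n st /= /andP[ncp cfw].
case: ifP => // ip nw sn wst; rewrite -sn in ip nw.
have [wst' sE] := trace_step_wf (ncp : noncrossing p) ip wst.
exact: IHw cfw nw sE wst'.
Qed.

Lemma trace_relabel n m w k st st' : crossing_free w -> target n w = Some m ->
  size (labels st') = n -> relabel k st st' ->
  relabel k (foldl trace_step st w) (foldl trace_step st' w).
Proof.
elim: w n st st' => [//|[p i] w IHw] n st st' /= /andP[ncp cfw].
case: ifP => // ip nw sn rst; rewrite -sn in ip nw.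
have [_ _ _ wst'] := rst.
have [_ sE] := trace_step_wf (ncp : noncrossing p) ip wst'.
by apply: IHw cfw nw sE _; apply: trace_step_relabel.
Qed.

(* What is retained of a reduction of [w] to [w'] by planar isotopies and the
   removal of [k] loops. *)
Definition reduces n m k w w' :=
  [/\ target n w = Some m, target n w' = Some m, crossing_free w',
      cls n m w = delta ^+ k *: cls n m w'
    & forall st, size (labels st) = n -> wf_state st ->
        relabel k (foldl trace_step st w) (foldl trace_step st w')].

Lemma reduces_refl n m w : crossing_free w -> target n w = Some m -> reduces n m 0 w w.
Proof.
move=> cfw nw; split; rewrite ?scale1r // => st sn wst.
by have [wst' _] := trace_wf cfw nw sn wst; apply: relabel_refl.
Qed.

Lemma scale_trans (R : nzRingType) (V : lmodType R) (d : R) k l (x y z : V) :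
  x = d ^+ k *: y -> y = d ^+ l *: z -> x = d ^+ (k + l) *: z.
Proof. by move=> -> ->; rewrite scalerA exprD. Qed.

Lemma reduces_trans n m k l w w' w'' :
  reduces n m k w w' -> reduces n m l w' w'' -> reduces n m (k + l) w w''.
Proof.
case=> nw nw' _ Ew rw [_ nw'' cfw'' Ew' rw'].
split; [exact: nw|exact: nw''|exact: cfw''|exact: scale_trans Ew Ew'|move=> st sn wst].
exact: relabel_trans (rw _ sn wst) (rw' _ sn wst).
Qed.

Lemma reduces_cat n m a b k u w w' v :
  crossing_free u -> crossing_free v -> target n u = Some a -> target b v = Some m ->
  reduces a b k w w' -> reduces n m k (u ++ w ++ v) (u ++ w' ++ v).
Proof.
move=> cfu cfv nu bv [aw aw' cfw' Ew rw].
have awv : target a (w ++ v) = Some m by rewrite (target_catE _ aw).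
have awv' : target a (w' ++ v) = Some m by rewrite (target_catE _ aw').
split; rewrite ?(target_catE _ nu) ?crossing_free_cat ?cfu ?cfw' //.
  rewrite -(stack_cls nu awv) -(stack_cls nu awv') -(stack_cls aw bv) -(stack_cls aw' bv).
  by rewrite Ew stackZl stackZr.
move=> st sn wst; rewrite !foldl_cat.
have [wst' sa] := trace_wf cfu nu sn wst.
have [_ sb] := trace_wf cfw' aw' sa wst'.
exact: trace_relabel cfv bv sb (rw _ sa wst').
Qed.

Lemma wf_stateS s c l l' : wf_state (s, c, l) -> wf_state (s, c.+1, l').
Proof. by apply: sub_all => z /= /ltnW. Qed.

Lemma wf_fresh s c l z : wf_state (s, c, l) -> z \in s -> (z == c) = false.
Proof. by move=> /allP sc /sc /= /ltn_eqF. Qed.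

Lemma reduces_loop n i : (i <= n)%N -> reduces n n 1 [:: (Cup, i); (Cap, i)] [::].
Proof.
move=> i_n; have tn : target n [:: (Cup, i); (Cap, i)] = Some n.
  by rewrite /= addn0 i_n; case: ifP => [_|]; [congr Some|]; lia.
split=> //; first by rewrite expr1; apply: (@cls_loop n n [::] i [::]).
move=> [[s c] l] /= sn wst; rewrite -sn in i_n.
have [x [y [Es Ex]]] := split_at i_n; subst i s.
rewrite trace_cup trace_cap eqxx; split=> //=.
- by exists id; rewrite ?map_id.
- by rewrite addn1.
exact: wf_stateS wst.
Qed.

Lemma reduces_zigzagl n i : (i < n)%N -> reduces n n 0 [:: (Cup, i); (Cap, i.+1)] [::].
Proof.
move=> i_n; have tn : target n [:: (Cup, i); (Cap, i.+1)] = Some n.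
  by rewrite /= addn0 (ltnW i_n); case: ifP => [_|]; [congr Some|]; lia.
split=> //.
  rewrite scale1r.
  by apply: (@cls_isotopy n n [::] _ [::] [::] (isotopy_zigzagl i)); rewrite ?cats0.
move=> [[s c] l] /= sn wst; rewrite -sn in i_n.
have [x [y [Es Ex]]] := split_at (ltnW i_n); subst i s.
case: y => [|z y] in sn wst i_n *; first by rewrite cats0 ltnn in i_n.
rewrite trace_cup; have := trace_cap (rcons x c) c z y c.+1 l.
rewrite size_rcons cat_rcons => ->.
have /wf_fresh zc := wst; rewrite eq_sym zc ?mem_cat ?inE ?eqxx ?orbT //=.
have Es : [seq (if w == z then c else w) | w <- x ++ z :: y] =
          [seq (if w == z then c else w) | w <- rcons x c ++ y].
  by rewrite cat_rcons !map_cat /= eqxx eq_sym zc ?mem_cat ?inE ?eqxx ?orbT.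
split=> //=.
(* The zigzag passes its fresh label [c] to the strand called [z] and to whatever is joined to it;
   [c] occurs nowhere else. *)
- exists (fun w => if w == z then c else w) => // w w' ws w's.
  case: eqP => [->|_]; case: eqP => [->|_] // /eqP; rewrite ?zc // eq_sym zc //.
- by rewrite addn0.
rewrite -Es /wf_state all_map; apply/allP => w ws /=; case: ifP => _ //.
by have /allP/(_ _ ws)/= := wst => /ltnW.
Qed.

Lemma reduces_zigzagr n i : (i < n)%N -> reduces n n 0 [:: (Cup, i.+1); (Cap, i)] [::].
Proof.
move=> i_n; have tn : target n [:: (Cup, i.+1); (Cap, i)] = Some n.
  by rewrite /= addn0 i_n; case: ifP => [_|]; [congr Some|]; lia.
split=> //.
  rewrite scale1r.
  by apply: (@cls_isotopy n n [::] _ [::] [::] (isotopy_zigzagr i)); rewrite ?cats0.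
move=> [[s c] l] /= sn wst; rewrite -sn in i_n.
have [x [y [Es Ex]]] := split_at (ltnW i_n); subst i s.
case: y => [|z y] in sn wst i_n *; first by rewrite cats0 ltnn in i_n.
rewrite -cat_rcons -(size_rcons x z) trace_cup cat_rcons trace_cap.
have /wf_fresh zc := wst; rewrite zc ?mem_cat ?inE ?eqxx ?orbT //=.
have -> : [seq (if w == c then z else w) | w <- x ++ c :: y] = x ++ z :: y.
  rewrite map_cat /= eqxx; congr (_ ++ _ :: _); apply: map_eq_in => w ws /=;
    by rewrite zc // mem_cat inE ws ?orbT.
rewrite cat_rcons; split=> //=.
- by exists id; rewrite ?map_id.
- by rewrite addn0.
exact: wf_stateS wst.
Qed.

Lemma reduces_cap_cup n i j : (i <= j)%N -> (j.+2 <= n)%N ->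
  reduces n n 0 [:: (Cup, j.+2); (Cap, i)] [:: (Cap, i); (Cup, j)].
Proof.
move=> ij jn.
have tn : target n [:: (Cup, j.+2); (Cap, i)] = Some n.
  by rewrite /= addn0 jn; case: ifP => [_|]; [congr Some|]; lia.
have tn' : target n [:: (Cap, i); (Cup, j)] = Some n.
  by rewrite /= !addn0; case: ifP => [_|]; [case: ifP => [_|]; [congr Some|]|]; lia.
split=> //.
  rewrite scale1r; symmetry.
  have := isotopy_exchange Cap Cup ij; rewrite /= addn0 addn2 => e.
  by apply: (@cls_isotopy n n [::] _ _ [::] e); rewrite ?cats0.
move=> [[s c] l] /= sn wst; rewrite -sn in jn.
have [x [a [b [y' [Es Ex]]]]] : exists x a b y', s = x ++ a :: b :: y' /\ size x = i.
  by apply: split_at2; lia.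
have [y [z [Ey Ez]]] : exists y z, y' = y ++ z /\ size y = (j - i)%N.
  by apply: split_at; move: jn; rewrite Es size_cat /= Ex; lia.
subst y' s i.
have Ej : j = size (x ++ y) by rewrite size_cat Ez; lia.
have Ej2 : j.+2 = size (x ++ a :: b :: y) by rewrite Ej !size_cat /= !addnS.
have -> : x ++ [:: a, b & y ++ z] = (x ++ a :: b :: y) ++ z by rewrite -catA.
rewrite Ej2 trace_cup -catA /= trace_cap -catA /= trace_cap.
have /wf_fresh fr := wst.
case: eqP => ab.
  rewrite (catA x y z) Ej trace_cup -catA; apply: relabel_refl.
  move: wst; rewrite /wf_state /= !all_cat /= ?all_cat /= => /and4P[xc _ _ /andP[yc zc]].
  rewrite !ltnSn /=; apply/and3P; split; [move: xc|move: yc|move: zc];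
    by apply: sub_all => w /= /ltnW.
have -> : [seq (if w == b then a else w) | w <- x ++ y ++ [:: c, c & z]] =
  ([seq (if w == b then a else w) | w <- x ++ y])
     ++ [:: c, c & [seq (if w == b then a else w) | w <- z]].
  by rewrite catA map_cat /= eq_sym fr // mem_cat !inE eqxx !orbT.
rewrite (catA x y z) (map_cat _ (x ++ y) z).
have -> : j = size [seq (if w == b then a else w) | w <- x ++ y] by rewrite size_map.
rewrite trace_cup; apply: relabel_refl.
move: wst; rewrite /wf_state /= !all_cat /= ?all_cat /= => /and4P[xc ac _ /andP[yc zc]].
rewrite !ltnSn !all_map /= all_cat; apply/andP; split; [apply/andP; split|];
  [move: xc|move: yc|move: zc]; by apply: sub_all => w /= wc; case: ifP => _; exact: ltnW.
Qed.

Lemma reduces_cup_cap n i j : (i <= j)%N -> (j.+2 <= n)%N ->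
  reduces n n 0 [:: (Cup, i); (Cap, j.+2)] [:: (Cap, j); (Cup, i)].
Proof.
move=> ij jn.
have tn : target n [:: (Cup, i); (Cap, j.+2)] = Some n.
  by rewrite /= addn0; case: ifP => [_|]; [case: ifP => [_|]; [congr Some|]|]; lia.
have tn' : target n [:: (Cap, j); (Cup, i)] = Some n.
  by rewrite /= !addn0; case: ifP => [_|]; [case: ifP => [_|]; [congr Some|]|]; lia.
split=> //.
  rewrite scale1r.
  have := isotopy_exchange Cup Cap ij; rewrite /= addn0 addn2 => e.
  by apply: (@cls_isotopy n n [::] _ _ [::] e); rewrite ?cats0.
move=> [[s c] l] /= sn wst; rewrite -sn in jn.
have [xy [a [b [z [Es Exy]]]]] : exists x a b y', s = x ++ a :: b :: y' /\ size x = j.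
  by apply: split_at2; lia.
have [x [y [Ey Ex]]] : exists y z, xy = y ++ z /\ size y = i.
  by apply: split_at; rewrite Exy.
subst xy s i j.
have -> : (x ++ y) ++ [:: a, b & z] = x ++ (y ++ [:: a, b & z]) by rewrite catA.
rewrite trace_cup.
have -> : (size (x ++ y)).+2 = size (x ++ c :: c :: y) by rewrite !size_cat /= !addnS.
have -> : x ++ [:: c, c & y ++ [:: a, b & z]] = (x ++ c :: c :: y) ++ [:: a, b & z].
  by rewrite -catA.
rewrite trace_cap catA trace_cap.
have /wf_fresh fr := wst.
case: eqP => ab.
  rewrite -!catA trace_cup; apply: relabel_refl.
  move: wst; rewrite /wf_state /= !all_cat /= ?all_cat /= => /andP[/andP[xc yc] /and3P[_ _ zc]].
  rewrite !ltnSn /= ?all_cat; apply/and3P; split; [move: xc|move: yc|move: zc];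
    by apply: sub_all => w /= /ltnW.
have -> : [seq (if w == b then a else w) | w <- (x ++ [:: c, c & y]) ++ z] =
  [seq (if w == b then a else w) | w <- x]
     ++ [:: c, c & [seq (if w == b then a else w) | w <- y ++ z]].
  by rewrite -catA map_cat /= eq_sym fr // mem_cat !inE eqxx !orbT.
rewrite -catA (map_cat _ x (y ++ z)).
have -> : size x = size [seq (if w == b then a else w) | w <- x] by rewrite size_map.
rewrite trace_cup; apply: relabel_refl.
move: wst; rewrite /wf_state /= !all_cat /= ?all_cat /= => /andP[/andP[xc yc] /and3P[ac _ zc]].
rewrite !ltnSn !all_map /= all_cat; apply/andP; split; [|apply/andP; split];
  [move: xc|move: yc|move: zc]; by apply: sub_all => w /= wc; case: ifP => _; exact: ltnW.
Qed.

Lemma target_rcons n w x m : target n (rcons w x) = Some m ->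
  exists2 k, target n w = Some k & target k [:: x] = Some m.
Proof. by rewrite -cats1 => /target_catP. Qed.

Lemma crossing_free_rcons w x :
  crossing_free (rcons w x) = noncrossing x.1 && crossing_free w.
Proof. exact: all_rcons. Qed.

Lemma target_Cup n i : (i <= n)%N -> target n [:: (Cup, i)] = Some n.+2.
Proof. by move=> i_n; rewrite /= addn0 i_n subn0 addn2. Qed.

Lemma target_Cap n i : (i <= n)%N -> target n.+2 [:: (Cap, i)] = Some n.
Proof. by move=> i_n; rewrite /= addn2 !ltnS i_n subn2 addn0. Qed.

Lemma target_CupP n i m : target n [:: (Cup, i)] = Some m -> (i <= n)%N /\ m = n.+2.
Proof. by rewrite /= addn0; case: ifP => // i_n [<-]; split; lia. Qed.

Lemma target_CapP n i m : target n [:: (Cap, i)] = Some m -> (i <= m)%N /\ n = m.+2.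
Proof. by rewrite /=; case: ifP => // i_n [<-]; split; lia. Qed.

(** The maximum descends through the minima, highest first. At equal positions they form a loop, at
    neighbouring ones a zigzag; otherwise they exchange heights and the maximum goes on below. *)
Lemma cups_cap_normal n m v i : all is_cup v -> target n v = Some m.+2 -> (i <= m)%N ->
  exists k u v', [/\ all is_cap u, all is_cup v' & reduces n m k (v ++ [:: (Cap, i)]) (u ++ v')].
Proof.
elim/last_ind: v m i => [|v [p j] IHv] m i.
  move=> _ [->] i_m; exists 0, [:: (Cap, i)], [::]; split=> //.
  by apply: reduces_refl => //; apply: target_Cap.
rewrite all_rcons => /andP[]; case: p => // _ cv /target_rcons[k nv].
move=> /target_CupP[jm []] Ek; subst k => im.
have cfv := cups_crossing_free cv; rewrite cat_rcons.
have pre a s s' : reduces m m a s s' -> reduces n m a (v ++ s) (v ++ s').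
  by move=> /(reduces_cat (u := v) (v := [::]) cfv isT nv erefl); rewrite !cats0.
have done0 a s : reduces m m a s [::] ->
    exists k u v', [/\ all is_cap u, all is_cup v' & reduces n m k (v ++ s) (u ++ v')].
  by move=> /pre; rewrite cats0 => rs; exists a, [::], v.
have push i' j' : reduces m m 0 [:: (Cup, j); (Cap, i)] [:: (Cap, i'); (Cup, j')] ->
    (i'.+2 <= m)%N -> (j'.+2 <= m)%N ->
    exists k u v', [/\ all is_cap u, all is_cup v'
      & reduces n m k (v ++ [:: (Cup, j); (Cap, i)]) (u ++ v')].
  (* After the exchange, [m - 2] strands run between the maximum and the minimum above it. *)
  move=> /pre rs im' jm'; have Em : m = (m - 2).+2 by lia.
  have [||a [u [v' [cu cv' red]]]] := IHv (m - 2)%N i' cv; rewrite -?Em //; first by lia.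
  have tC : target (m - 2) [:: (Cup, j')] = Some m.
    by rewrite [in RHS]Em; apply: target_Cup; lia.
  exists (0 + a)%N, u, (rcons v' (Cup, j')); split=> //; first by rewrite all_rcons.
  have := reduces_cat (u := [::]) (v := [:: (Cup, j')]) isT isT erefl tC red.
  rewrite /= -!catA (cats1 v') => red''; exact: (reduces_trans rs red'').
have [ij|ij|->] := ltngtP i j; last by apply/done0/reduces_loop.
  have [Ej|ij'] := eqVneq j i.+1.
    by apply: (done0 0); rewrite Ej; apply: reduces_zigzagr; lia.
  case: j => [|[|j]] // in ij ij' jm pre push done0 *; first by lia.
  by apply: (push i j); [apply: reduces_cap_cup|..]; lia.
have [Ei|ij'] := eqVneq i j.+1.
  by apply: (done0 0); rewrite Ei; apply: reduces_zigzagl; lia.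
case: i => [|[|i]] // in ij ij' im pre push done0 *; first by lia.
by apply: (push i j); [apply: reduces_cup_cap|..]; lia.
Qed.

Lemma crossing_free_normal n m w : crossing_free w -> target n w = Some m ->
  exists k u v, [/\ all is_cap u, all is_cup v & reduces n m k w (u ++ v)].
Proof.
elim/last_ind: w m => [|w [p i] IHw] m.
  by exists 0, [::], [::]; split=> //; apply: reduces_refl.
rewrite crossing_free_rcons => /andP[ncp cfw] /target_rcons[k nw kp].
have [a [u [v [cu cv red]]]] := IHw k cfw nw; rewrite -cats1.
have cfp : crossing_free [:: (p, i)] by rewrite /crossing_free /= -/(noncrossing p) ncp.
have := reduces_cat (u := [::]) (v := [:: (p, i)]) isT cfp erefl kp red.
case: red => _ /target_catP[l nu lv] _ _ _.
rewrite /= -catA; case: p ncp kp {cfp} => [||//] _ kp red.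
  by exists a, u, (v ++ [:: (Cup, i)]); rewrite all_cat cv.
have [im Ek] := target_CapP kp; subst k.
have [b [u' [v' [cu' cv' red']]]] := cups_cap_normal cv lv im.
exists (a + b)%N, (u ++ u'), v'; rewrite all_cat cu; split=> //.
apply: reduces_trans red _.
have := reduces_cat (v := [::]) (caps_crossing_free cu) isT nu erefl red'.
by rewrite !cats0 -catA.
Qed.

Lemma target_caps n m u : all is_cap u -> target n u = Some m -> (m + 2 * size u)%N = n.
Proof.
elim: u n => [n _ [->]|[p i] u IHu] /=; first by rewrite muln0 addn0.
move=> n /andP[]; case: p => // _ cu; rewrite [inputs _]/= [outputs _]/=.
by case: ifP => // i_n /(IHu _ cu); lia.
Qed.

Lemma target_cups n m v : all is_cup v -> target n v = Some m -> (n + 2 * size v)%N = m.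
Proof.
elim: v n => [n _ [->]|[p i] v IHv] /=; first by rewrite muln0 addn0.
move=> n /andP[]; case: p => // _ cv; rewrite [inputs _]/= [outputs _]/=.
by case: ifP => // i_n /(IHv _ cv); lia.
Qed.

Lemma wf_trace0 n : wf_state (iota 0 n, n, 0%N).
Proof. by apply/allP => z; rewrite mem_iota. Qed.

Lemma caps_trace n m u st : all is_cap u -> target n u = Some m ->
  size (labels st) = n -> uniq (labels st) ->
  uniq (labels (foldl trace_step st u)) /\ loops (foldl trace_step st u) = loops st.
Proof.
elim: u n st => [//|[p i] u IHu] n [[s c] l] /= /andP[]; case: p => // _ cu.
case: ifP => // + nu sn; rewrite -sn => is_ us.
have [x [a [b [y [Es Ex]]]]] := split_at2 (is_ : (i + 2 <= size s)%N); subst s i.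
rewrite trace_cap; move: us; rewrite cat_uniq /= !inE !negb_or -!andbA.
move=> /and5P[ux xa xb xy /and4P[ab ay yb uy]]; rewrite (negPf ab).
have bxy : b \notin x ++ y by rewrite mem_cat negb_or xb.
rewrite (_ : [seq _ | z <- x ++ y] = x ++ y); last first.
  by apply: map_eq_in => z zs /=; rewrite ifN //; apply: contraNneq bxy => <-.
apply: IHu cu nu _ _ => /=; first by rewrite -sn !size_cat /=; lia.
by rewrite cat_uniq ux xy.
Qed.

Lemma cups_trace v st : all is_cup v -> v != [::] -> ~~ uniq (labels (foldl trace_step st v)).
Proof.
elim/last_ind: v => [//|v [p i] _]; rewrite all_rcons => /andP[]; case: p => // _ _ _.
rewrite -cats1 foldl_cat /=; case: (foldl _ _ _) => [[s c] l].
by rewrite /trace_step /= cat_uniq /= !inE eqxx /= !andbF.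
Qed.

Lemma caps_basis_diagram n h (d : tangle n h) : all is_cap d -> basis_diagram d.
Proof.
move=> cd; have [|u l] :=
  caps_trace cd (tangle_target d) (st := (iota 0 n, n, 0%N)) _ (iota_uniq 0 n).
  exact: size_iota.
by apply/and3P; split; rewrite ?caps_crossing_free //; apply/eqP.
Qed.

(** A minimum in the normal form would put two equal labels on top, and every removed loop is a
    closed component; [relabel] carries both back to [d], where they are excluded. *)
Lemma basis_diagram_caps n h (d : tangle n h) : basis_diagram d ->
  exists u, [/\ all is_cap u, target n u = Some h & skein_class d = cls n h u].
Proof.
case/and3P => cfd /eqP d0 ud.
have [k [u [v [cu cv [_ nuv _ Ed rd]]]]] := crossing_free_normal cfd (tangle_target d).
have [|[f f_inj Ef] El _ _] := rd (iota 0 n, n, 0%N) _ (wf_trace0 n); first exact: size_iota.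
have [v0|v0] := eqVneq v [::]; last first.
  move: ud; rewrite /top_labels /trace Ef => /map_uniq.
  by rewrite foldl_cat (negPf (cups_trace _ cv v0)).
rewrite v0 cats0 in nuv Ed El; exists u; split=> //.
move: d0; rewrite /closed_components /trace El => /eqP; rewrite addn_eq0 => /andP[_ /eqP k0].
by rewrite -clsE Ed k0 expr0 scale1r.
Qed.

(** Maxima cannot act on 0 points and minima cannot end at 0, so the normal form is empty and [k] is
    the number of closed components. *)
Lemma bracket_closed w : crossing_free w -> target 0 w = Some 0%N ->
  bracket (cls 0 0 w) = delta ^+ closed_components 0 w.
Proof.
move=> cfw w0.
have [k [u [v [cu cv [_ /target_catP[l u0 v0] _ Ew rw]]]]] := crossing_free_normal cfw w0.
have Eu : u = [::] by apply/nilP; have := target_caps cu u0; rewrite /nilp; lia.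
have Ev : v = [::] by apply/nilP; have := target_cups cv v0; rewrite /nilp; lia.
rewrite Ew Eu Ev (linZ bracket_linear) -TL_oneE bracket_one.
have [_] := rw (iota 0 0, 0%N, 0%N) erefl isT.
rewrite Eu Ev /= add0n => El _ _; rewrite /closed_components /trace El.
exact: mulr1.
Qed.

(** * The skein category *)

Lemma bracket_eval_linear c (x y : skein 0 0) :
  bracket (c *: x + y) = c * bracket x + bracket y.
Proof. exact: bracket_linear. Qed.

Definition skein_TL : TL_category delta := {|
  tl_hom := fun n m => skein n m;
  tl_comp := stack;
  tl_id := TL_one;
  tl_wid := wid;
  tl_flip := refl;
  tl_cap := cap;
  tl_cup := cup;
  tl_comp_linearl := fun n k m => @stack_linearl n k m;
  tl_comp_linearr := fun n k m => @stack_linearr n k m;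
  tl_compA := stackA;
  tl_comp1l := stack1l;
  tl_comp1r := stack1r;
  tl_wid_linear := wid_linear;
  tl_wid_comp := wid_stack;
  tl_wid1 := wid_one;
  tl_flip_linear := refl_linear;
  tl_flip_comp := refl_stack;
  tl_flip1 := refl_one;
  tl_flip_wid := refl_wid;
  tl_flip_cap := refl_cap;
  tl_flip_cup := refl_cup;
  tl_flipK := reflK;
  tl_cup_cap := cup_cap;
  tl_wid_cup_cap := wid_cup_cap;
  tl_cup_wid_cap := cup_wid_cap;
  tl_cap_natural := cap_natural;
  tl_cup_natural := cup_natural;
  tl_eval := bracket;
  tl_eval_linear := bracket_eval_linear;
  tl_eval1 := bracket_one |}.

(** * The Jones-Wenzl idempotent *)

Definition hook_word n i : skein n n := cls n n [:: (Cap, i); (Cup, i)].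

Lemma target_hook_word n i : (i.+2 <= n)%N -> target n [:: (Cap, i); (Cup, i)] = Some n.
Proof. by move=> i_n; rewrite /= addn2 i_n addn0; case: ifP => [_|]; [congr Some|]; lia. Qed.

Lemma wid_hook_word n i : (i.+2 <= n)%N -> wid (hook_word n i) = hook_word n.+1 i.
Proof. by move=> i_n; apply: wid_cls; apply: target_hook_word. Qed.

Lemma last_hook_word n : last_hook skein_TL n = hook_word n.+2 n.
Proof. exact: stack_cls (target_cap n) (target_cup n). Qed.

Lemma is_hook_word n i : (i.+2 <= n)%N -> @is_hook _ _ skein_TL n (hook_word n i).
Proof.
elim: n => [//|n IHn] i_n; have [i_n'|i_n'] := leqP i.+2 n.
  by left; exists (hook_word n i); [exact: IHn|rewrite -wid_hook_word].
have En : n = i.+1 by lia.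
by subst n; right; rewrite last_hook_word.
Qed.

Lemma is_hookP n (x : skein n n) : @is_hook _ _ skein_TL n x ->
  exists2 i, (i.+2 <= n)%N & x = hook_word n i.
Proof.
elim: n x => [//|n IHn] x [[y /IHn[i i_n Ey] ->]|].
  by exists i; [exact: leqW|rewrite Ey; exact: wid_hook_word].
case: n {IHn} x => [//|n] x ->; exists n => //; exact: last_hook_word.
Qed.

Lemma hookE n (i : 'I_n.-1) : hook i = hook_word n i.
Proof. by rewrite /hook -clsE. Qed.

Lemma ord_hook n i : (i.+2 <= n)%N -> exists j : 'I_n.-1, hook_word n i = hook j.
Proof.
move=> i_n; have i_n' : (i < n.-1)%N by lia.
by exists (Ordinal i_n'); rewrite hookE.
Qed.

Lemma hook_span_algebra n (x : skein n n) :
  @hook_span _ _ skein_TL n x -> hook_algebra x.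
Proof.
elim=> {x} [|x /is_hookP[i i_n ->]|x y _ hx _ hy|c x _ hx|x y _ hx _ hy].
- exact: hook_algebra0.
- by have [j ->] := ord_hook i_n; apply: hook_algebra_hook.
- exact: hook_algebraD.
- exact: hook_algebraZ.
exact: hook_algebraM.
Qed.

Lemma hook_algebra_span n (x : skein n n) :
  hook_algebra x -> @hook_span _ _ skein_TL n x.
Proof.
elim=> {x} [|i|x y _ hx _ hy|c x _ hx|x y _ hx _ hy].
- exact: hook_span0.
- apply: hook_span_hook; rewrite hookE; apply: is_hook_word.
  by case: i => i /= i_n; lia.
- exact: (@hook_spanD _ _ skein_TL).
- exact: (@hook_spanZ _ _ skein_TL).
exact: (@hook_spanM _ _ skein_TL).
Qed.

(** * Quantum integers *)

Lemma A_sub1_unit m : (0 < m)%N -> A ^+ m - 1 \is a GRing.unit.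
Proof.
move=> m0; rewrite [_ \is a _]unfold_in /= /Lambda_unit.
have Ev : val (A ^+ m - 1) = tofrac ('X^m - 1 : {poly int}).
  by rewrite rmorphB rmorphXn rmorph1 /= tofracB tofracXn tofrac1.
have v0 : tofrac ('X^m - 1 : {poly int}) != 0.
  by rewrite tofrac_eq0 monic_neq0 // monicXnsubC.
rewrite Ev v0 /=; apply/asboolP; exists 1, 0%N, [:: m.-1].
by rewrite /Lambda_den big_seq1 expr0 mul1r prednK // rmorph1 div1r.
Qed.

(** Multiplying by the unit [A ^+ (2 * m)] gives A^(4m) - 1, which the localization inverts. *)
Lemma quantum_unit m : (0 < m)%N -> A ^+ (2 * m) - A ^- (2 * m) \is a GRing.unit.
Proof.
move=> m0; have Au : A ^+ (2 * m) \is a GRing.unit by rewrite unitrX // A_unit.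
rewrite -(unitrMr _ Au) mulrBr divrr // -exprD; apply: A_sub1_unit; lia.
Qed.

Lemma Delta_unit m : Delta m \is a GRing.unit.
Proof.
rewrite /Delta unitrMl ?unitrX ?unitrN1 // unitrMl ?quantum_unit //.
by rewrite unitrV (@quantum_unit 1).
Qed.

Lemma A2VK : A ^+ 2 * A ^- 2 = 1.
Proof. by rewrite divrr // unitrX // A_unit. Qed.

Lemma quantum_rec (R : comNzRingType) (y z : R) m : y * z = 1 ->
  y ^+ m.+3 - z ^+ m.+3 = (y + z) * (y ^+ m.+2 - z ^+ m.+2) - (y ^+ m.+1 - z ^+ m.+1).
Proof.
move=> yz; apply/eqP; rewrite -subr_eq0; apply/eqP.
(* The defect of the recursion is a multiple of [1 - y * z]. *)
transitivity ((1 - y * z) * (y ^+ m.+1 - z ^+ m.+1)); last by rewrite yz subrr mul0r.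
by rewrite !exprS; ring.
Qed.

Lemma DeltaE m : Delta m =
  (-1) ^+ m * (((A ^+ 2) ^+ m.+1 - (A ^- 2) ^+ m.+1) / (A ^+ 2 - A ^- 2)).
Proof. by rewrite /Delta !exprM exprVn. Qed.

Lemma Delta0 : Delta 0 = 1.
Proof. by rewrite DeltaE expr0 mul1r !expr1 divrr // (@quantum_unit 1). Qed.

Lemma Delta1 : Delta 1 = delta.
Proof.
rewrite DeltaE /delta; have := @quantum_unit 1 isT; rewrite muln1.
move: (A ^+ 2) (A ^- 2) => y z u.
have -> : y ^+ 2 - z ^+ 2 = (y + z) * (y - z) by ring.
by rewrite mulrK // expr1; ring.
Qed.

Lemma DeltaSS m : Delta m.+2 = delta * Delta m.+1 - Delta m.
Proof.
rewrite !DeltaE /delta (quantum_rec _ A2VK).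
move: (A ^+ 2 - A ^- 2)^-1 => w; move: (A ^+ 2) (A ^- 2) => y z.
move: (y ^+ m.+2) (z ^+ m.+2) (y ^+ m.+1) (z ^+ m.+1) => a b c d.
by rewrite !exprS; move: ((-1) ^+ m) => s; ring.
Qed.

Lemma delta_unit : delta \is a GRing.unit.
Proof. by rewrite -Delta1 Delta_unit. Qed.

Local Notation jones_wenzl := (jw skein_TL Delta).

(** The recursive projector shows that [xget] has something to choose, and uniqueness identifies the
    choice. *)
Lemma jones_wenzlP h : Jones_Wenzl h = jones_wenzl h.
Proof.
have jwP : is_Jones_Wenzl (jones_wenzl h).
  split.
  - move=> i; rewrite hookE.
    have hi : @is_hook _ _ skein_TL h (hook_word h i).
      by apply: is_hook_word; case: i => i /= ih; lia.
    split; first exact: (jw_killsr Delta0 Delta1 DeltaSS Delta_unit hi).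
    exact: (jw_killsl Delta0 Delta1 DeltaSS Delta_unit hi).
  - exact/hook_span_algebra/(jw_hook_span skein_TL Delta0 Delta1 DeltaSS Delta_unit).
  - exact: (jw_idem skein_TL Delta0 Delta1 DeltaSS Delta_unit).
have [kf hf _] : is_Jones_Wenzl (Jones_Wenzl h).
  by apply: (@xgetPex _ 0 [set f | is_Jones_Wenzl f]); exists (jones_wenzl h).
apply: (@projector_unique _ _ skein_TL).
- move=> e /is_hookP[i /ord_hook[j ->] ->]; exact: (kf j).1.
- exact: hook_algebra_span.
- exact: (jw_killsl Delta0 Delta1 DeltaSS Delta_unit).
exact: (jw_hook_span skein_TL Delta0 Delta1 DeltaSS Delta_unit).
Qed.

Lemma hook_word_cup h i : (i <= h)%N ->
  stack (cls h h.+2 [:: (Cup, i)]) (hook_word h.+2 i) = delta *: cls h h.+2 [:: (Cup, i)].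
Proof.
move=> ih; have tU := target_Cup ih; have tH : target h.+2 [:: (Cap, i); (Cup, i)] = Some h.+2.
  exact: target_hook_word.
rewrite (stack_cls tU tH).
apply: (@cls_loop h h.+2 [::] i [:: (Cup, i)]).
have -> : [::] ++ [:: (Cup, i); (Cap, i)] ++ [:: (Cup, i)] =
  [:: (Cup, i)] ++ [:: (Cap, i); (Cup, i)] by [].
by rewrite (target_catE _ tU) tH.
Qed.

(** A hook inserted between the minimum and [f] multiplies the minimum by the unit [delta], yet
    makes the product vanish. *)
Lemma killsl_cup h i (f : skein h.+2 h.+2) : (i <= h)%N ->
  @killsl _ _ skein_TL _ f -> stack (cls h h.+2 [:: (Cup, i)]) f = 0.
Proof.
move=> ih kf; have kfi : stack (hook_word h.+2 i) f = 0 by apply/kf/is_hook_word.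
have E : delta *: stack (cls h h.+2 [:: (Cup, i)]) f = 0.
  by rewrite -stackZl -(hook_word_cup ih) -stackA kfi stack0r.
by rewrite -[LHS]scale1r -(mulVr delta_unit) -scalerA E scaler0.
Qed.

Lemma killsl_cups n h u v (f : skein h h) : all is_cup v -> v != [::] ->
  target n (u ++ v) = Some h -> @killsl _ _ skein_TL _ f ->
  stack (cls n h (u ++ v)) f = 0.
Proof.
case/lastP: v => [//|v [p i]]; rewrite all_rcons => /andP[]; case: p => // _ cv _.
rewrite -cats1 catA => nuv kf; have [k nk kh] := target_catP nuv.
have [ik Eh] := target_CupP kh; subst h.
by rewrite -(stack_cls nk kh) -stackA killsl_cup // stack0r.
Qed.

(** * The natural basis *)

(** The alternatives are the two kinds of last step in [path_basis]. If the last bottom point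
    belongs to a maximum, [cap_natural] pulls that maximum above all later layers, and [u'] consists
    of the remaining ones. *)
Lemma caps_last n h u : all is_cap u -> target n.+1 u = Some h ->
  (exists2 h', h = h'.+1 & target n u = Some h') \/
  (exists u', [/\ all is_cap u', target n u' = Some h.+1
    & cls n.+1 h u = stack (wid (cls n h.+1 u')) (cap h)]).
Proof.
elim: u n => [|[p i] u IHu] n; first by move=> _ [<-]; left; exists n.
rewrite [all _ _]/= => /andP[]; case: p => // _ cu.
rewrite -cat1s => /target_catP[k nk ku].
have [ik En] := target_CapP nk.
case: k ik En nk ku => [|k] ik En nk ku.
  have Ei : i = 0%N by lia.
  case: En => En; subst n i; right; exists u; split=> //; first by rewrite (target_wid ku).
  rewrite -(stack_cls nk ku) -[cls 2 0 _]/(cap 0) (cap_natural (cls 0 h u)).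
  by rewrite (wid_cls ku).
case: En => En; subst n.
have [ik'|ik'] := leqP i k.
  have nk' : target k.+2 [:: (Cap, i)] = Some k by apply: target_Cap.
  case: (IHu k cu ku) => [[h' Eh kh']|[u' [cu' ku' Eu]]].
    by left; exists h' => //; rewrite -cat1s (target_catE _ nk').
  right; exists ((Cap, i) :: u'); split=> //.
    by rewrite -cat1s (target_catE _ nk').
  rewrite -(stack_cls nk ku) Eu stackA -(wid_cls nk') -wid_stack.
  by rewrite (stack_cls nk' ku').
have Ei : i = k.+1 by lia.
subst i; right; exists u; split=> //; first by rewrite (target_wid ku).
rewrite -(stack_cls nk ku) -[cls _ _ [:: _]]/(cap k.+1) (cap_natural (cls k.+1 h u)).
by rewrite (wid_cls ku).
Qed.

Local Notation path_skein n h := (@path_basis _ _ skein_TL n h).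

Lemma path_skein_caps n h (i : 'I_(npaths n h)) :
  exists u, [/\ all is_cap u, target n u = Some h & path_skein n h i = cls n h u].
Proof.
elim: n h i => [|n IHn] h.
  by case: h => [|h] i; [exists [::]; rewrite /= TL_oneE|case: i].
have step k (j : 'I_(npaths n k.+1)) : exists u, [/\ all is_cap u,
    target n.+1 u = Some k & @down _ _ skein_TL n k (path_skein n k.+1 j) = cls n.+1 k u].
  have [u [cu nu Eu]] := IHn _ j; have nu' := target_wid nu.
  exists (u ++ [:: (Cap, k)]); rewrite all_cat cu (target_catE _ nu') target_cap.
  split=> //; rewrite /down Eu; rewrite -(stack_cls nu' (target_cap k)).
  by rewrite -(wid_cls nu).
case: h => [|h] i; first exact: step.
rewrite [path_skein _ _ _]/=.
case: (@fintype.split (npaths n h) (npaths n h.+2) i) => j; last exact: step.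
have [u [cu nu Eu]] := IHn _ j; exists u; split=> //; first exact: target_wid.
by rewrite Eu -(wid_cls nu).
Qed.

Lemma caps_path_skein n h u : all is_cap u -> target n u = Some h ->
  exists i, cls n h u = path_skein n h i.
Proof.
elim: n h u => [|n IHn] h u cu nu.
  have [Eu Eh] : u = [::] /\ h = 0%N.
    by have E := target_caps cu nu; split; [apply/nilP; rewrite /nilp|]; lia.
  by subst u h; exists ord0; rewrite /= TL_oneE.
have [[h' Eh nu']|[u' [cu' nu' Eu]]] := caps_last cu nu.
  subst h; have [i Ei] := IHn _ _ cu nu'.
  exists (lshift (npaths n h'.+2) i); rewrite -(wid_cls nu') Ei [RHS]/=.
  by rewrite (unsplitK (inl i)).
have [i Ei] := IHn _ _ cu' nu'; rewrite Eu Ei.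
case: h {nu Eu nu'} i Ei => [|h] i Ei; first by exists i.
by exists (rshift (npaths n h) i); rewrite [RHS]/= (unsplitK (inr i)).
Qed.

Lemma sum_scale0 (R : nzRingType) (V : lmodType R) (I : finType) (x : I -> V) :
  \sum_i (0 : R) *: x i = 0.
Proof. by rewrite big1 // => i _; rewrite scale0r. Qed.

Lemma sum_scale_delta (R : nzRingType) (V : lmodType R) (I : finType) c i (x : I -> V) :
  \sum_j (c *+ (j == i) : R) *: x j = c *: x i.
Proof.
rewrite (bigD1 i) //= eqxx big1 ?addr0 // => j /negPf->; exact: scale0r.
Qed.

(** Supplies the hypothesis [span]: in normal form, minima on top are killed by [f], and a word of
    maxima is a path element, with a power of [delta] from the removed loops. *)
Lemma skein_span n h (f : skein h h) : @killsl _ _ skein_TL h f ->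
  forall x : skein n h, exists c : 'I_(npaths n h) -> Lambda,
    stack x f = \sum_i c i *: stack (path_skein n h i) f.
Proof.
move=> kf; apply: crossing_free_ind => [|x y [c Ec] [c' Ec']|a x [c Ec]|w cfw nw].
- by exists (fun _ => 0); rewrite stack0l sum_scale0.
- exists (fun i => c i + c' i); rewrite stackDl Ec Ec' -big_split /=.
  by apply: eq_bigr => i _; rewrite scalerDl.
- exists (fun i => a * c i); rewrite stackZl Ec scaler_sumr.
  by apply: eq_bigr => i _; rewrite scalerA.
have [k [u [v [cu cv [_ nuv _ Ew _]]]]] := crossing_free_normal cfw nw.
have [v0|v0] := eqVneq v [::]; last first.
  exists (fun _ => 0); rewrite Ew stackZl (killsl_cups cv v0 nuv kf) scaler0.
  by rewrite sum_scale0.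
rewrite v0 cats0 in nuv Ew; have [i Ei] := caps_path_skein cu nuv.
exists (fun j => delta ^+ k *+ (j == i)); rewrite Ew Ei stackZl.
exact/esym/(sum_scale_delta _ _ (fun i => stack (path_skein n h i) f)).
Qed.

(** * The gluing form *)

Local Notation tl_closure := (@closure _ _ skein_TL _).

Definition closure_word h (w : seq layer) : seq layer :=
  [seq (Cup, i) | i <- iota 0 h] ++ w ++ rev [seq (Cap, i) | i <- iota 0 h].

(** The arc created last is the innermost and closes the rightmost strand, just as [ptrace] does. *)
Lemma closure_wordS h w :
  closure_word h.+1 w = closure_word h ((Cup, h) :: w ++ [:: (Cap, h)]).
Proof.
by rewrite /closure_word -addn1 iotaD !map_cat rev_cat /= add0n -!catA.
Qed.

Lemma closure_cls h w : target h w = Some h ->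
  target 0 (closure_word h w) = Some 0%N /\
  tl_closure (cls h h w) = bracket (cls 0 0 (closure_word h w)).
Proof.
elim: h w => [|h IHh] w hw; first by rewrite /closure_word cats0.
have hw' := target_wid hw.
have hCw : target h ((Cup, h) :: w) = Some h.+2.
  by rewrite -cat1s (target_catE _ (target_cup h)).
have hCwC : target h ((Cup, h) :: w ++ [:: (Cap, h)]) = Some h.
  by rewrite -cat_cons (target_catE _ hCw) target_cap.
have [tw Ew] := IHh _ hCwC; rewrite closure_wordS; split=> //; rewrite -Ew.
have E : @ptrace _ _ skein_TL h (cls h.+1 h.+1 w) =
    cls h h ((Cup, h) :: w ++ [:: (Cap, h)]).
  rewrite -cat_cons -(stack_cls hCw (target_cap h)) -[(Cup, h) :: w]cat1s.
  by rewrite -(stack_cls (target_cup h) hw') -(wid_cls hw).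
exact: (congr1 (@closure _ _ skein_TL h) E).
Qed.

Definition glue_form n h (x y : skein n h) : Lambda :=
  tl_closure (stack (refl y) x).

Lemma glue_form_linearl n h (y : skein n h) : linear (fun x => glue_form x y : Lambda^o).
Proof.
by move=> c x x'; rewrite /glue_form (stack_linearr (refl y)) (closure_linear (C := skein_TL)).
Qed.

Lemma glue_form_linearr n h (x : skein n h) : linear (fun y => glue_form x y : Lambda^o).
Proof.
move=> c y y'; rewrite /glue_form refl_linear (stack_linearl x).
by rewrite (closure_linear (C := skein_TL)).
Qed.

Lemma glue_formP n h : is_gluing_form (@glue_form n h).
Proof.
split; first by split; [exact: glue_form_linearl|exact: glue_form_linearr].
move=> d d' cfd cfd'; rewrite -!clsE /glue_form.
have td := tangle_target d; have td' := tangle_target d'.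
rewrite (refl_cls td') (stack_cls (target_flip td') td) (flip_word_reflect cfd').
have tw : target h (reflect_word d' ++ d) = Some h.
  by rewrite -(flip_word_reflect cfd') (target_catE _ (target_flip td')).
have [t0 ->] := closure_cls tw; rewrite /closure_word -catA in t0 *.
rewrite bracket_closed // !crossing_free_cat cfd.
have cfr : crossing_free (reflect_word d').
  by rewrite /crossing_free /reflect_word all_rev all_map; apply: sub_all cfd' => -[[]].
have cfU s : crossing_free [seq (Cup, i) | i <- s] by apply/allP => _ /mapP[i _ ->].
have cfC s : crossing_free (rev [seq (Cap, i) | i <- s]).
  by apply/allP => x; rewrite mem_rev => /mapP[i _ ->].
by rewrite cfU cfr cfC.
Qed.

(** Two gluing forms agree on crossing-free classes, which span in each argument. *)
Lemma gluing_formE n h (x y : skein n h) : gluing_form x y = glue_form x y.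
Proof.
have [[Bl Br] BE] : is_gluing_form (@gluing_form n h).
  apply: (@xgetPex _ (fun _ _ => 0) [set B | @is_gluing_form n h B]).
  by exists (@glue_form n h); apply: glue_formP.
have [_ GE] := @glue_formP n h.
move: x; apply: crossing_free_ind => [|x x' Ex Ex'|c x Ex|w cfw nw].
- by rewrite (lin0 (Bl y : linear (_ : _ -> Lambda^o))) (lin0 (glue_form_linearl y)).
- by rewrite (linD (Bl y : linear (_ : _ -> Lambda^o))) (linD (glue_form_linearl y)) Ex Ex'.
- by rewrite (linZ (Bl y : linear (_ : _ -> Lambda^o))) (linZ (glue_form_linearl y)) Ex.
move: y; apply: crossing_free_ind => [|y y' Ey Ey'|c y Ey|w' cfw' nw'].
- by rewrite (lin0 (Br _ : linear (_ : _ -> Lambda^o))) (lin0 (glue_form_linearr _)).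
- by rewrite (linD (Br _ : linear (_ : _ -> Lambda^o))) (linD (glue_form_linearr _)) Ey Ey'.
- by rewrite (linZ (Br _ : linear (_ : _ -> Lambda^o))) (linZ (glue_form_linearr _)) Ey.
case/target_tangle: nw cfw => d <- cfd; case/target_tangle: nw' cfw' => d' <- cfd'.
by rewrite !clsE BE // GE.
Qed.

Lemma gram_form_place n h (x y : skein n h) :
  gram_form (place x) (place y) = @form _ _ skein_TL Delta n h x y.
Proof. by rewrite /gram_form gluing_formE /glue_form /form /= jones_wenzlP. Qed.

Lemma natural_basisE n h :
  natural_basis n h = range (fun i => place (path_skein n h i)).
Proof.
apply/seteqP; split=> [_ [d bd <-]|_ [i _ <-]].
  have [u [cu nu ->]] := basis_diagram_caps bd.
  by have [i ->] := caps_path_skein cu nu; exists i.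
have [u [cu nu ->]] := path_skein_caps i; case/target_tangle: nu cu => d <- cd.
by exists d; [exact: caps_basis_diagram|rewrite clsE].
Qed.

(** * Exponents *)

Lemma binomE n x : binom n%:R (x%:R / 2) = half_bin n x.
Proof.
rewrite /binom /half_bin natr_nat /=.
have [xo|xe] := boolP (odd x); last first.
  have -> : (x%:R / 2 : rat) = (x./2)%:R.
    rewrite -[x in LHS]odd_double_half (negPf xe) add0n -muln2 natrM mulfK //.
  by rewrite natr_nat !natrK.
case: ifP => // /natrP[m Em]; exfalso.
have Ex : (x%:R : rat) = (m * 2)%:R.
  by rewrite natrM -Em divfK.
by move/eqP: Ex; rewrite eqr_nat => /eqP Ex; rewrite Ex muln2 odd_double in xo.
Qed.

Lemma alphaE n h k : (0 < k)%N -> alpha n h k = ndown k n h.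
Proof.
case: k => // k _; rewrite /alpha -natrB; last by lia.
rewrite !binomE.
have -> : (n + h + 2 * k.+1 - 2 * minn k.+1.-1 h)%N = (n + h + 2 * k - 2 * minn k h).+2.
  by rewrite /=; lia.
have -> : (n + h + 2 * k.+1 + 2)%N = (n + h + 2 * k).+4 by lia.
by rewrite -ndownE PoszD addrK.
Qed.

(** Makes the product of the theorem finite. In [ndownE] the binomial on the right is already out of
    range. *)
Lemma ndown_big k n h : (n + h < k)%N -> ndown k n h = 0%N.
Proof.
case: k => // k nk; have := ndownE k n h.
by rewrite [RHS]half_bin_big; lia.
Qed.

Lemma D_pathsP n h (a : n.+1.-tuple nat) :
  D_paths n.+1 h a <-> (val a \in path_seqs n.+1 h).
Proof.
rewrite mem_path_seqs size_tuple eqxx /= -nth_last size_tuple /=.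
case: a => -[//|x a] /= sa; split.
  case=> /= -> Ea adj; rewrite Ea eqxx andbT; apply/(pathP 0%N) => i ia.
  have := adj i; rewrite -(eqP sa) ltnS => /(_ ia) /=.
  by rewrite /adjacent; lia.
case/andP=> [/andP[x1 /(pathP 0%N) ax] /eqP Ea]; split=> //=.
  by move: x1; rewrite /adjacent /=; case: eqP => //=; lia.
move=> i; rewrite -(eqP sa) ltnS => ia; have := ax i ia.
by rewrite /adjacent /=; lia.
Qed.

Lemma card_DE n h : (0 < n)%N -> card_D n h = npaths n h.
Proof.
case: n => // n _; rewrite /card_D.
pose s : seq (n.+1.-tuple nat) := pmap insub (path_seqs n.+1 h).
have -> : D_paths n.+1 h = [set` [fset a in s]%fset].
  apply/seteqP; split=> a; rewrite /= !inE mem_pmap_sub; by move/D_pathsP.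
rewrite set_fsetK card_fseq undup_id; last exact/pmap_sub_uniq/path_seqs_uniq.
rewrite size_pmap_sub -size_path_seqs; apply/eqP; rewrite -all_count; apply/allP => a.
by rewrite mem_path_seqs => /and3P[].
Qed.

(** * The determinant *)

Lemma det_path_gram n h :
  \det (\matrix_(i, j) gram_form (place (path_skein n h i)) (place (path_skein n h j))) =
  Delta h ^+ npaths n h *
    \prod_(1 <= k < (n + h).+1) (Delta k / Delta k.-1) ^+ ndown k n h.
Proof.
have span n' h' f : @killsl _ _ skein_TL h' f -> forall x : skein_TL n' h', _ :=
  @skein_span n' h' f.
rewrite -(det_gram Delta0 Delta1 DeltaSS Delta_unit span (leqnn _)).
rewrite -(det_form skein_TL Delta_unit); congr (\det _); apply/matrixP => i j.
by rewrite !mxE gram_form_place.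
Qed.

Lemma det_path_gram_neq0 n h :
  \det (\matrix_(i, j) gram_form (place (path_skein n h i)) (place (path_skein n h j))) != 0.
Proof.
suff u : Delta h ^+ npaths n h *
    \prod_(1 <= k < (n + h).+1) (Delta k / Delta k.-1) ^+ ndown k n h \is a GRing.unit.
  by rewrite det_path_gram; apply: contraTneq u => ->; rewrite unitr0.
rewrite unitrMl ?unitrX ?Delta_unit //.
apply: (big_ind (fun x => x \is a GRing.unit)); first exact: unitr1.
  by move=> x y ux uy; rewrite unitrMl.
by move=> k _; rewrite unitrX // unitrMl ?unitrV Delta_unit.
Qed.

(** A coincidence would give the Gram matrix two equal rows, hence determinant 0. *)
Lemma place_path_inj n h : injective (fun i => place (path_skein n h i)).
Proof.
move=> i j Eij; apply/eqP/negP => /negP ij.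
have /eqP := det_path_gram_neq0 n h; apply.
by apply: (determinant_alternate ij) => k; rewrite !mxE Eij.
Qed.

(** The permutation acts on rows and on columns, so its sign is squared. *)
Lemma det_reindex (R : comNzRingType) n (s : 'I_n -> 'I_n) (M : 'M[R]_n) :
  injective s -> \det (\matrix_(i, j) M (s i) (s j)) = \det M.
Proof.
move=> s_inj; have -> : \matrix_(i, j) M (s i) (s j) =
    row_perm (perm s_inj) (col_perm (perm s_inj) M).
  by apply/matrixP => i j; rewrite !mxE !permE.
rewrite row_permE col_permE !det_mulmx !det_perm odd_permV mulrCA -signr_addb addbb.
by rewrite mulr1.
Qed.

(** Both families are injective with the same range, so the index maps [s] and [t] are mutually
    inverse; this forces [N = npaths n h]. *)
Lemma det_enum n h N (b : 'I_N -> colored n h) :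
  set_bij setT (natural_basis n h) b ->
  \det (\matrix_(i, j) gram_form (b i) (b j)) =
  \det (\matrix_(i, j) gram_form (place (path_skein n h i)) (place (path_skein n h j))).
Proof.
case=> b_fun b_inj b_surj; rewrite natural_basisE in b_fun b_surj.
have /fin_all_exists[s Es] i : exists j, b i = place (path_skein n h j).
  by have [j _ <-] := b_fun i I; exists j.
have /fin_all_exists[t Et] j : exists i, b i = place (path_skein n h j).
  by have [|i _ <-] := b_surj (place (path_skein n h j)); [exists j|exists i].
have sK : cancel s t by move=> i; apply: b_inj; [exact: mem_set|exact: mem_set|rewrite Et -Es].
have tK : cancel t s by move=> j; apply: place_path_inj; rewrite -Es Et.
have EN : N = npaths n h.
  by rewrite -[N]card_ord -[RHS]card_ord; apply: bij_eq_card; exists t; [exact: sK|exact: tK].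
subst N; rewrite -[RHS](det_reindex _ (can_inj sK)); congr (\det _).
by apply/matrixP => i j; rewrite !mxE -!Es.
Qed.

(* [b] enumerates the natural basis. *)
Theorem theorem2p11 (n h N : nat) (b : 'I_N -> colored n h)
    (n_gt0 : (0 < n)%N) (b_basis : set_bij setT (natural_basis n h) b) :
  \det (\matrix_(i < N, j < N) gram_form (b i) (b j))
  = Delta h ^+ card_D n h *
    \big[*%R/1]_(k \in [set k : nat | (1 <= k)%N])
      (Delta k / Delta k.-1) ^ alpha n h k.
Proof.
rewrite (det_enum b_basis) det_path_gram card_DE //; congr (_ * _).
(* Beyond [n + h] all exponents vanish, so the product over all positive [k] is the finite one. *)
rewrite (fsbigE (index_iota 1 (n + h).+1)) ?iota_uniq //=; first last.
- move=> k k0; rewrite mem_index_iota k0 /= -leqNgt => nk.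
  by rewrite alphaE // ndown_big // expr0z.
- by move=> k /=; rewrite mem_index_iota => /andP[].
rewrite big_seq_cond [RHS]big_seq_cond; apply: eq_big => [k|k].
  rewrite andbT mem_index_iota; apply/idP/andP => [kn|[]//]; split=> //.
  by apply/mem_set; case/andP: kn.
by rewrite andbT mem_index_iota => /andP[k0 _]; rewrite alphaE.
Qed.
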